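(* Let $S\subset\mathbb{Z}_+$ be a proper cofinite set of positive integers, $f(x)=1-\sum_{k\in S}x^k$, $p$ the smallest root of $f$ and $r$ the magnitude of the second smallest root. Let $V_n$ denote variance with respect to the uniform probability measure on the set of $S$-restricted compositions of $n$, and let $\mathbf{B}(\vec\lambda)=\prod_i\lambda_i$. There exist constants $b_1>0$ and $b_0$ such that, for any $q\in(p,\min(1,r))$, $$V_n(\log\mathbf{B})=b_1n+b_0+O\!\left(n^2\left(\tfrac{p}{q}\right)^n\right).$$ Specifically, with all sums over $k\in S$, $$b_1=\frac{\left(\sum(\log k)p^k\right)^2\sum k^2p^k}{\left(\sum kp^k\right)^3}-\frac{2\sum(\log k)p^k\sum k(\log k)p^k}{\left(\sum kp^k\right)^2}+\frac{\sum(\log k)^2p^k}{\sum kp^k}$$ and $$b_0=\frac{2\left(\sum(\log k)p^k\right)^2\left(\sum k^2p^k\right)^2}{\left(\sum kp^k\right)^4}-\frac{\left(\sum(\log k)p^k\right)^2\sum k^3p^k+4\sum(\log k)p^k\sum k(\log k)p^k\sum k^2p^k}{\left(\sum kp^k\right)^3}$$ $$+\frac{\left(\sum k(\log k)p^k\right)^2+\sum(\log k)^2p^k\sum k^2p^k+2\sum(\log k)p^k\sum k^2(\log k)p^k}{\left(\sum kp^k\right)^2}-\frac{\sum k(\log k)^2p^k}{\sum kp^k}.$$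
   Context: ''Proper cofinite'' means $\mathbb{Z}_+\setminus S$ is finite and nonempty. An $S$-restricted composition of $n$ is a finite sequence $(\lambda_1,\dots,\lambda_\ell)$ of elements of $S$ summing to $n$. The function $f$ extends to a rational function on $\mathbb{C}$ (using $\sum_{k\ge1}x^k=x/(1-x)$) whose roots are the zeros of the polynomial $(1-x)f(x)$. The root of smallest magnitude is a real number $p\in(\tfrac12,1)$ of multiplicity one and all other roots have magnitude strictly greater than $p$; $r$ denotes the minimum of $|z|$ over roots $z\ne p$ of $f$. *)

(* Defs.v *)
From HB Require Import structures.
From mathcomp Require Import all_boot all_order all_algebra.
From mathcomp Require Import finmap complex.
From mathcomp Require Import all_classical all_reals all_analysis.

Set Implicit Arguments.
Unset Strict Implicit.
Unset Printing Implicit Defensive.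

Import Order.TTheory GRing.Theory Num.Theory.
Import numFieldNormedType.Exports.

Local Open Scope classical_set_scope.
Local Open Scope ring_scope.

Definition gaps (S : set nat) : set nat := [set k | (0 < k)%N /\ ~ S k].

Definition proper_cofinite (S : set nat) : Prop :=
  [/\ S `<=` [set k | (0 < k)%N], finite_set (gaps S) & gaps S !=set0].

Definition sumS (R : realType) (S : set nat) (a : nat -> R) : R :=
  \big[+%R/0]_(0 <= k <oo | k \in S) a k.

Definition f_series (R : realType) (S : set nat) (x : R) : R :=
  1 - sumS S (fun k => x ^+ k).

(* The rational extension of f_series to the complex plane:
   \sum_(k in S) x ^ k is \sum_(k >= 1) x ^ k = x / (1 - x) minus the finite sum
   over the positive integers outside S. It has a pole at 1. *)
Definition f_ext (R : realType) (S : set nat) (x : R[i]) : R[i] :=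
  1 - (x / (1 - x) - \sum_(k \in gaps S) x ^+ k).

Lemma f_extE (R : realType) (S : set nat) (x : R) : proper_cofinite S -> `|x| < 1 ->
  f_ext S x%:C%C = (f_series S x)%:C%C.
Proof.
rewrite /f_series; move=> [S0 finG _] x1.
have x10 : 1 - x != 0 by rewrite subr_eq0; apply/eqP => xE; move: x1; rewrite -xE normr1 ltxx.
have -> : sumS S (fun k => x ^+ k) = x / (1 - x) - \sum_(k <- fset_set (gaps S)) x ^+ k.
  rewrite /sumS; apply/cvg_lim => //.
  have [N HN] : exists N, forall k, k \in fset_set (gaps S) -> (k < N)%N.
    exists (\max_(k <- fset_set (gaps S)) k).+1 => k kG.
    by rewrite ltnS (big_rem k)//= leq_maxl.
  have nS0 : (0%N \in S) = false by apply/negP; rewrite inE => /S0.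
  have nG0 : (0%N \in gaps S) = false by apply/negP; rewrite inE => -[].
  have step n : (N <= n)%N -> (0 < n)%N -> \sum_(0 <= k < n | k \in S) x ^+ k =
     series (geometric 1 x) n - 1 - \sum_(k <- fset_set (gaps S)) x ^+ k.
    move=> Nn n0.
    have -> : \sum_(k <- fset_set (gaps S)) x ^+ k = \sum_(0 <= k < n | k \in gaps S) x ^+ k.
      rewrite -[RHS]big_filter; apply/perm_big/uniq_perm; rewrite ?fset_uniq ?filter_uniq ?iota_uniq//.
      move=> k; rewrite mem_filter mem_index_iota /= in_fset_set//.
      by case: (boolP (k \in gaps S)) => //= kG; rewrite (leq_trans _ Nn)// HN// in_fset_set.
    have -> : series (geometric 1 x) n = \sum_(0 <= k < n) x ^+ k.
      by rewrite /series /=; apply: eq_bigr => k _; rewrite mul1r.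
    rewrite (big_ltn n0) [LHS](big_ltn_cond n0) nS0.
    rewrite [\sum_(0 <= k < n | k \in gaps S) _](big_ltn_cond n0) nG0 /= expr0.
    rewrite [1 + _]addrC addrK.
    apply/esym/eqP; rewrite subr_eq (bigID (fun k => k \in S)) /=.
    apply/eqP; congr (_ + _); rewrite big_nat_cond [RHS]big_nat_cond; apply: eq_bigl => k.
    case: k => [|k]//=; congr andb; apply/idP/idP.
      by rewrite notin_setE => kS; rewrite inE.
    by rewrite inE => -[_ kS]; rewrite notin_setE.
  have : series (geometric 1 x) n - 1 - \sum_(k <- fset_set (gaps S)) x ^+ k @[n --> \oo] -->
      x / (1 - x) - \sum_(k <- fset_set (gaps S)) x ^+ k.
    have -> : x / (1 - x) = 1 / (1 - x) - 1.
      by rewrite -[X in _ = _ - X](divff x10) -mulrBl opprB addrCA subrr addr0.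
    by apply: cvgB; [apply: cvgB; [exact: cvg_geometric_series|exact: cvg_cst]|exact: cvg_cst].
  apply: cvg_trans; apply: near_eq_cvg; near=> n; rewrite step//; near: n.
    exact: nbhs_infty_ge.
  exact: nbhs_infty_gt.
rewrite /f_ext fsbig_finite//.
rewrite !(rmorphB, rmorph1, rmorphM, fmorphV, rmorph_sum) /=.
by congr (1 - (_ - _)); apply: eq_bigr => k _; rewrite rmorphXn.
Unshelve. all: by end_near. Qed.

(* The value of f_ext at its pole 1 is junk, as 0^-1 = 0. *)
Definition is_root (R : realType) (S : set nat) (z : R[i]) : Prop :=
  z != 1 /\ f_ext S z = 0.

(* The roots are the zeros of the polynomial (1 - x) f(x). *)
Lemma is_rootE (R : realType) (S : set nat) (z : R[i]) :
  is_root S z <-> (1 - z) * (1 + \sum_(k \in gaps S) z ^+ k) - z = 0.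
Proof.
rewrite /is_root /f_ext; set s := \sum_(_ \in _) _.
have [->|z1] := eqVneq z 1.
  rewrite subrr mul0r sub0r; split; first by case.
  by move/eqP; rewrite oppr_eq0 oner_eq0.
have z10 : 1 - z != 0 by rewrite subr_eq0 eq_sym.
have -> : (1 - z) * (1 + s) - z = (1 - z) * (1 - (z / (1 - z) - s)).
  rewrite opprB addrCA addrC !mulrDr mulrN [X in _ = _ - X + _]mulrCA divff// mulr1 mulr1.
  by rewrite [RHS]addrC addrA [X in _ = X - z]addrC.
split=> [[_ ->]|/eqP]; first by rewrite mulr0.
by rewrite mulf_eq0 (negPf z10) => /eqP ?; split.
Qed.

Definition smallest_root (R : realType) (S : set nat) (p : R) : Prop :=
  is_root S p%:C%C /\ forall z : R[i], is_root S z -> `|p%:C%C| <= `|z|.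

Definition second_smallest_modulus (R : realType) (S : set nat) (p r : R) : Prop :=
  (exists z : R[i], [/\ is_root S z, z != p%:C%C & `|z| = r%:C%C]) /\
  forall z : R[i], is_root S z -> z != p%:C%C -> r%:C%C <= `|z|.

Definition compositions (S : set nat) (n : nat) : set (seq nat) :=
  [set s : seq nat | (forall k, k \in s -> S k) /\ sumn s = n].

(* Mean and variance of X under the uniform probability measure on A, for A
   finite and nonempty (both are 0 for A empty, and meaningless for A infinite). *)
Definition unif_mean (R : realType) (T : choiceType) (A : set T) (X : T -> R) : R :=
  (\sum_(t \in A) X t) / #|` fset_set A|%fset%:R.

Definition unif_var (R : realType) (T : choiceType) (A : set T) (X : T -> R) : R :=
  unif_mean A (fun t => (X t - unif_mean A X) ^+ 2).

Definition partprod (s : seq nat) : nat := \prod_(k <- s) k.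

Definition logB (R : realType) (s : seq nat) : R := ln (partprod s)%:R.

Definition moment (R : realType) (S : set nat) (p : R) (i j : nat) : R :=
  sumS S (fun k => k%:R ^+ i * ln k%:R ^+ j * p ^+ k).

Definition b1_formula (R : realType) (S : set nat) (p : R) : R :=
  let K := moment S p 1 0 in
  let K2 := moment S p 2 0 in
  let L := moment S p 0 1 in
  let KL := moment S p 1 1 in
  let L2 := moment S p 0 2 in
  L ^+ 2 * K2 / K ^+ 3 - 2 * L * KL / K ^+ 2 + L2 / K.

Definition b0_formula (R : realType) (S : set nat) (p : R) : R :=
  let K := moment S p 1 0 in
  let K2 := moment S p 2 0 in
  let K3 := moment S p 3 0 in
  let L := moment S p 0 1 in
  let KL := moment S p 1 1 in
  let K2L := moment S p 2 1 in
  let L2 := moment S p 0 2 in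
  let KL2 := moment S p 1 2 in
  2 * L ^+ 2 * K2 ^+ 2 / K ^+ 4
  - (L ^+ 2 * K3 + 4 * L * KL * K2) / K ^+ 3
  + (KL ^+ 2 + L2 * K2 + 2 * L * K2L) / K ^+ 2
  - KL2 / K.

(* Main.v *)
Require Import Defs.
From HB Require Import structures.
From mathcomp Require Import all_boot all_order all_algebra.
From mathcomp Require Import finmap complex.
From mathcomp Require Import all_classical all_reals all_analysis.
From mathcomp Require Import ring lra zify.

Set Implicit Arguments.
Unset Strict Implicit.
Unset Printing Implicit Defensive.

Import Order.TTheory GRing.Theory Num.Theory.
Import numFieldNormedType.Exports.

Local Open Scope classical_set_scope.
Local Open Scope ring_scope.

(** The sums over the compositions of n of 1, log B and (log B)^2 are the
coefficients of 1/f, l/f^2 and l2/f^2 + 2 l^2/f^3, where l and l2 are the series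
of log k x^k and (log k)^2 x^k over k in S. Since (1 - x) f(x) is a polynomial,
1/f is 1/(x - p) times a series g whose coefficients are O(q^-n): g is a
polynomial divided by the product of the factors x - z over the zeros z <> p, and
each 1/(x - z) is a geometric series. After rescaling by p the pole sits at 1, and
any series h with coefficients decaying geometrically is h(1) + (1 - x) h' with h'
decaying as well. So the coefficients of h/(1 - x)^m are a polynomial in n, given
by the moments sum k^i h_k, up to a geometrically decaying error. The moments of g
follow from those of f through f g = 1 - x and the Leibniz rule. *)

(** * Formal power series *)

(** A separate name for [nat -> K], so that its product can be the Cauchy product instead of the
    pointwise one. *)
Definition fps (K : comNzRingType) := nat -> K.

HB.instance Definition _ (K : comNzRingType) :=
  GRing.Zmodule.copy (fps K) (nat -> K).

Definition fps_one (K : comNzRingType) : fps K := fun n => (n == 0%N)%:R.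
Definition fps_mul (K : comNzRingType) (a b : fps K) : fps K :=
  fun n => \sum_(i < n.+1) a i * b (n - i)%N.

(** Coefficient [n] of a product only sees coefficients up to [n], so the ring laws can be inherited
    from polynomials. *)
Lemma fps_mul_trunc (K : comNzRingType) (a b : fps K) N n : (n < N)%N ->
  fps_mul a b n = ((\poly_(i < N) a i) * (\poly_(i < N) b i))`_n.
Proof.
move=> nN; rewrite coefM; apply: eq_bigr => i _.
by rewrite !coef_poly (leq_ltn_trans (leq_subr _ _) nN) (leq_ltn_trans _ nN)// -ltnS.
Qed.

Lemma fps_mulA (K : comNzRingType) : associative (@fps_mul K).
Proof.
move=> a b c; apply/funext => n.
transitivity ((\poly_(i < n.+1) a i * (\poly_(i < n.+1) b i * \poly_(i < n.+1) c i))`_n).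
  rewrite coefM; apply: eq_bigr => i _.
  by rewrite coef_poly ltn_ord -fps_mul_trunc// ltnS leq_subr.
rewrite mulrA coefM; apply: eq_bigr => i _.
by rewrite -fps_mul_trunc// coef_poly ltnS leq_subr.
Qed.

Lemma fps_mulC (K : comNzRingType) : commutative (@fps_mul K).
Proof. by move=> a b; apply/funext => n; rewrite !(@fps_mul_trunc _ _ _ n.+1)// mulrC. Qed.

Lemma fps_mul1 (K : comNzRingType) : left_id (@fps_one K) (@fps_mul K).
Proof.
move=> a; apply/funext => n; rewrite /fps_mul big_ord_recl /= subn0 mul1r.
by rewrite big1 ?addr0// => i _; rewrite mul0r.
Qed.

Lemma fps_mulDl (K : comNzRingType) : left_distributive (@fps_mul K) +%R.
Proof.
move=> a b c; apply/funext => n; rewrite [RHS]/GRing.add /= -big_split.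
by apply: eq_bigr => i _; rewrite mulrDl.
Qed.

Lemma fps_one_neq0 (K : comNzRingType) : fps_one K != 0.
Proof. by apply/eqP => /(congr1 (fun a : fps K => a 0%N)) /eqP; rewrite oner_eq0. Qed.

HB.instance Definition _ (K : comNzRingType) :=
  GRing.Zmodule_isComNzRing.Build (fps K)
    (@fps_mulA K) (@fps_mulC K) (@fps_mul1 K) (@fps_mulDl K) (@fps_one_neq0 K).


Lemma fpsM (K : comNzRingType) (a b : fps K) n :
  (a * b) n = \sum_(i < n.+1) a i * b (n - i)%N.
Proof. by []. Qed.

Lemma fpsD (K : comNzRingType) (a b : fps K) n : (a + b) n = a n + b n.
Proof. by []. Qed.

Lemma fpsN (K : comNzRingType) (a : fps K) n : (- a) n = - a n.
Proof. by []. Qed.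

Lemma fps1 (K : comNzRingType) n : (1 : fps K) n = (n == 0%N)%:R.
Proof. by []. Qed.

Lemma fps_muln (K : comNzRingType) (a : fps K) k n : (a *+ k) n = a n *+ k.
Proof. by elim: k => [|k IH]; rewrite ?mulr0n// !mulrS fpsD IH. Qed.

(** * Elementary series, the derivation and the rescaling *)

Definition fpsC (K : comNzRingType) (c : K) : fps K := fun n => c *+ (n == 0%N).
Definition fpsX (K : comNzRingType) : fps K := fun n => (n == 1%N)%:R.
Definition geom (K : comNzRingType) (x : K) : fps K := fun n => x ^+ n.
(** The derivation x d/dx; it multiplies coefficient [n] by [n], so its iterates produce moments. *)
Definition euler (K : comNzRingType) (a : fps K) : fps K := fun n => n%:R * a n.
(** The substitution of p x for x, which moves a pole at [p] to 1. *)
Definition scale (K : comNzRingType) (p : K) (a : fps K) : fps K := fun n => a n * p ^+ n.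
Definition fps_poly (K : comNzRingType) (P : {poly K}) : fps K := fun n => P`_n.

Lemma fpsCM (K : comNzRingType) (c : K) (a : fps K) n : (fpsC c * a) n = c * a n.
Proof.
rewrite fpsM big_ord_recl /= subn0 /fpsC big1 ?addr0 ?mulr1n// => i _.
by rewrite /= mulr0n mul0r.
Qed.

Lemma fpsXM0 (K : comNzRingType) (a : fps K) : (fpsX K * a) 0%N = 0.
Proof. by rewrite fpsM big_ord1 mul0r. Qed.

Lemma fpsXMS (K : comNzRingType) (a : fps K) n : (fpsX K * a) n.+1 = a n.
Proof.
rewrite fpsM big_ord_recl mul0r add0r big_ord_recl /= mul1r subn1 /=.
by rewrite big1 ?addr0// => i _; rewrite mul0r.
Qed.

Lemma fpsC_mul (K : comNzRingType) (c d : K) : fpsC (c * d) = fpsC c * fpsC d.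
Proof. by apply/funext => n; rewrite fpsCM /fpsC mulrnAr. Qed.

Lemma fpsC1 (K : comNzRingType) : fpsC (1 : K) = 1.
Proof. by []. Qed.

Lemma geomV (K : comNzRingType) (x : K) : (1 - fpsC x * fpsX K) * geom x = 1.
Proof.
rewrite mulrBl mul1r -mulrA; apply/funext => -[|n].
  by rewrite fpsD fpsN fpsCM fpsXM0 mulr0 subr0.
by rewrite fpsD fpsN fpsCM fpsXMS /geom -exprS subrr.
Qed.

Lemma eulerD (K : comNzRingType) (a b : fps K) : euler (a + b) = euler a + euler b.
Proof. by apply/funext => n; rewrite /euler !fpsD mulrDr. Qed.

Lemma eulerN (K : comNzRingType) (a : fps K) : euler (- a) = - euler a.
Proof. by apply/funext => n; rewrite /euler !fpsN mulrN. Qed.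

Lemma euler1 (K : comNzRingType) : euler (1 : fps K) = 0.
Proof. by apply/funext => -[|n]; rewrite /euler fps1 (mul0r, mulr0). Qed.

Lemma eulerX (K : comNzRingType) : euler (fpsX K) = fpsX K.
Proof. by apply/funext => -[|[|n]]; rewrite /euler /fpsX (mul0r, mul1r, mulr0). Qed.

Lemma eulerM (K : comNzRingType) (a b : fps K) :
  euler (a * b) = euler a * b + a * euler b.
Proof.
apply/funext => n; rewrite /euler fpsD !fpsM mulr_sumr -big_split; apply: eq_bigr => i _ /=.
have -> : n%:R = i%:R + (n - i)%:R :> K by rewrite -natrD subnKC// -ltnS.
by rewrite mulrDl mulrA; congr (_ + _); rewrite mulrCA.
Qed.

Lemma scaleD (K : comNzRingType) (p : K) (a b : fps K) : scale p (a + b) = scale p a + scale p b.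
Proof. by apply/funext => n; rewrite /scale !fpsD mulrDl. Qed.

Lemma scaleN (K : comNzRingType) (p : K) (a : fps K) : scale p (- a) = - scale p a.
Proof. by apply/funext => n; rewrite /scale !fpsN mulNr. Qed.

Lemma scale1 (K : comNzRingType) (p : K) : scale p 1 = 1.
Proof. by apply/funext => -[|n]; rewrite /scale fps1 ?mul0r// expr0 mulr1. Qed.

Lemma scaleM (K : comNzRingType) (p : K) (a b : fps K) : scale p (a * b) = scale p a * scale p b.
Proof.
apply/funext => n; rewrite /scale fpsM mulr_suml fpsM; apply: eq_bigr => i _.
have -> : p ^+ n = p ^+ i * p ^+ (n - i) by rewrite -exprD subnKC// -ltnS.
by rewrite mulrACA.
Qed.

Lemma fps_polyM (K : comNzRingType) (P Q : {poly K}) : fps_poly (P * Q) = fps_poly P * fps_poly Q.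
Proof. by apply/funext => n; rewrite /fps_poly coefM. Qed.

(** * Geometrically decaying coefficients *)

(** A form of t^n - u^n >= n u^(n-1) (t - u): a linear factor is absorbed by enlarging the ratio
    from [u] to [t]. *)
Lemma natr_exp_le (K : numFieldType) (u t : K) n : 0 <= u -> u < t ->
  n%:R * u ^+ n * (t - u) <= u * t ^+ n.
Proof.
move=> u0 ut; have tu0 : 0 <= t - u by rewrite subr_ge0 ltW.
elim: n => [|n IH]; first by rewrite !mul0r expr0 mulr1.
have utn : u ^+ n <= t ^+ n by rewrite lerXn2r// ?nnegrE// ltW// (le_lt_trans u0).
have -> : n.+1%:R * u ^+ n.+1 * (t - u) =
    u * (n%:R * u ^+ n * (t - u)) + u * (t - u) * u ^+ n.
  by rewrite -natr1 exprS; ring.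
have -> : u * t ^+ n.+1 = u * (u * t ^+ n) + u * (t - u) * t ^+ n.
  by rewrite exprS; ring.
by apply: lerD; rewrite ler_wpM2l// mulr_ge0.
Qed.

(* The coefficients of a decay faster than s ^- n, with some room: this room
   absorbs polynomial factors. *)
Definition decay (K : numFieldType) (s : K) (a : fps K) :=
  exists2 t, s < t & exists C : K, forall n, `|a n| * t ^+ n <= C.

Section decay.
Variables (K : numFieldType) (s : K).
Hypothesis s0 : 0 <= s.

Lemma decay_at (a : fps K) : decay s a ->
  exists2 t, s < t & exists2 C : K, 0 <= C & forall n, `|a n| * t ^+ n <= C.
Proof.
move=> [t st [C HC]]; exists t => //; exists C => //.
by apply: le_trans (HC 0%N); rewrite mulr_ge0// expr0.
Qed.

Lemma decay_shrink (a : fps K) t u C : 0 <= u -> u <= t ->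
  (forall n, `|a n| * t ^+ n <= C) -> forall n, `|a n| * u ^+ n <= C.
Proof.
move=> u0 ut H n; apply: le_trans (H n).
by rewrite ler_wpM2l// lerXn2r// ?nnegrE// (le_trans u0).
Qed.

Lemma decay_at2 (a b : fps K) : decay s a -> decay s b ->
  exists2 t, s < t & exists2 C : K, 0 <= C &
    forall n, `|a n| * t ^+ n <= C /\ `|b n| * t ^+ n <= C.
Proof.
move=> /decay_at [t st [C C0 HC]] /decay_at [u su [D D0 HD]].
have t0 := le_trans s0 (ltW st); have u0 := le_trans s0 (ltW su).
have CD x : (x <= C) || (x <= D) -> x <= C + D.
  by case/orP => /le_trans; apply; rewrite ?lerDl ?lerDr.
(* The order of [K] may be partial, as on the complex numbers; the two rates are comparable because
   both are nonnegative. *)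
case/orP: (real_leVge (ger0_real t0) (ger0_real u0)) => tu.
  exists t => //; exists (C + D); first exact: addr_ge0.
  by move=> n; split; apply: CD; rewrite ?HC// (decay_shrink t0 tu HD) orbT.
exists u => //; exists (C + D); first exact: addr_ge0.
by move=> n; split; apply: CD; rewrite ?HD ?orbT// (decay_shrink u0 tu HC).
Qed.

Lemma decay_dom (a b : fps K) : (forall n, `|a n| <= `|b n|) -> decay s b -> decay s a.
Proof.
move=> ab [t st [C HC]]; exists t => //; exists C => n; apply: le_trans (HC n).
by rewrite ler_wpM2r// exprn_ge0// (le_trans s0)// ltW.
Qed.

Lemma decayD (a b : fps K) : decay s a -> decay s b -> decay s (a + b).
Proof.
move=> da db; have [t st [C _ H]] := decay_at2 da db; exists t => //; exists (C + C) => n.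
have [Ha Hb] := H n; apply: le_trans (lerD Ha Hb).
by rewrite -mulrDl ler_wpM2r ?ler_normD// exprn_ge0// (le_trans s0)// ltW.
Qed.

Lemma decayN (a : fps K) : decay s a -> decay s (- a).
Proof. by apply: decay_dom => n; rewrite fpsN normrN. Qed.

(** The factor [n] is paid for by lowering the rate from [t] to the midpoint of [s] and [t]. *)
Lemma decay_euler (a : fps K) : decay s a -> decay s (euler a).
Proof.
move=> /decay_at [t st [C C0 HC]]; exists ((s + t) / 2); first by rewrite midf_lt.
set u := _ / _; have ut : u < t by rewrite midf_lt.
have u0 : 0 <= u by rewrite divr_ge0// addr_ge0// (le_trans s0)// ltW.
have tu0 : 0 < t - u by rewrite subr_gt0.
exists (u * C / (t - u)) => n; rewrite ler_pdivlMr//.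
rewrite /euler normrM normr_nat.
have -> : n%:R * `|a n| * u ^+ n * (t - u) = `|a n| * (n%:R * u ^+ n * (t - u)) by ring.
apply: le_trans (_ : `|a n| * (u * t ^+ n) <= _); first by rewrite ler_wpM2l// natr_exp_le.
by rewrite mulrCA ler_wpM2l.
Qed.

(** Each of the n + 1 terms of the convolution contributes at most C^2 once t^n is split as t^i
    t^(n-i). *)
Lemma decay_boundM (a b : fps K) t C n : 0 <= t -> 0 <= C ->
  (forall n, `|a n| * t ^+ n <= C /\ `|b n| * t ^+ n <= C) ->
  `|(a * b) n| * t ^+ n <= (n%:R + 1) * (C * C).
Proof.
move=> t0 C0 H; rewrite fpsM.
apply: le_trans (_ : \sum_(i < n.+1) (`|a i| * t ^+ i) * (`|b (n - i)%N| * t ^+ (n - i)) <= _).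
  rewrite (le_trans (ler_wpM2r _ (ler_norm_sum _ _ _))) ?exprn_ge0// mulr_suml.
  apply: ler_sum => i _; rewrite mulrACA -exprD subnKC; last by rewrite -ltnS.
  by rewrite normrM.
rewrite natr1 -[n.+1 in leRHS]card_ord mulr_natl -sumr_const; apply: ler_sum => i _.
have [Ha _] := H i; have [_ Hb] := H (n - i)%N.
by apply: ler_pM => //; rewrite mulr_ge0// exprn_ge0.
Qed.

Lemma decayM (a b : fps K) : decay s a -> decay s b -> decay s (a * b).
Proof.
move=> da db; have [t st [C C0 H]] := decay_at2 da db.
have t0 : 0 < t := le_lt_trans s0 st.
(* The product is dominated by C^2 (n + 1) t^-n, which is C^2 times [euler w + w] and so decays. *)
pose w : fps K := fun n => t ^- n.
have dw : decay s w.
  exists t => //; exists 1 => n; rewrite /w ger0_norm; last by rewrite invr_ge0 exprn_ge0// ltW.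
  by rewrite mulVf// expf_eq0 gt_eqF// andbF.
have dd : decay s (fpsC (C * C) * (euler w + w)).
  have dW : decay s (euler w + w) by apply: decayD => //; apply: decay_euler.
  case: dW => u su [D HD]; exists u => //; exists (C * C * D) => n.
  have CC0 : 0 <= C * C by rewrite mulr_ge0.
  by rewrite fpsCM normrM (ger0_norm CC0) -[leLHS]mulrA ler_wpM2l.
apply: decay_dom dd => n; rewrite fpsCM fpsD /euler -{2}[w n]mul1r -mulrDl.
rewrite [leRHS]ger0_norm; last by rewrite !mulr_ge0// ?addr_ge0// invr_ge0 exprn_ge0// ltW.
rewrite mulrA /w ler_pdivlMr ?exprn_gt0// [_ * (_ + _)]mulrC.
exact: decay_boundM (ltW t0) C0 H.
Qed.

Lemma decay_finite (a : fps K) N : (forall n, (N <= n)%N -> a n = 0) -> decay s a.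
Proof.
move=> aN; exists (s + 1); first by rewrite ltrDl.
exists (\sum_(i < N) `|a i| * (s + 1) ^+ i) => n.
have s10 : 0 <= s + 1 by rewrite addr_ge0.
have Hge (i : 'I_N) : true -> 0 <= `|a i| * (s + 1) ^+ i by rewrite mulr_ge0// exprn_ge0.
have [Nn|nN] := leqP N n; first by rewrite aN// normr0 mul0r sumr_ge0.
by rewrite (bigD1 (Ordinal nN))//= lerDl sumr_ge0// => i _; apply: Hge.
Qed.

Lemma decayC (c : K) : decay s (fpsC c).
Proof. by apply: (@decay_finite _ 1) => -[]. Qed.

Lemma decayX : decay s (fpsX K).
Proof. by apply: (@decay_finite _ 2) => -[|[]]. Qed.

Lemma decay1 : decay s (1 : fps K).
Proof. exact: decayC. Qed.

Lemma decay_geom (x : K) : s * `|x| < 1 -> decay s (geom x).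
Proof.
move=> sx; have [->|x0] := eqVneq x 0.
  by apply: (@decay_finite _ 1) => -[]// n _; rewrite /geom expr0n.
exists `|x|^-1; first by rewrite -[ltRHS]mul1r ltr_pdivlMr ?normr_gt0.
by exists 1 => n; rewrite /geom normrX -exprMn mulfV ?normr_eq0// expr1n.
Qed.

End decay.

(** * Value and moments at 1 *)

Ltac decay_closed := repeat first
  [ assumption | exact: decayC | exact: decayX | exact: decay1
  | apply: decayN | apply: decayM | apply: decayD | apply: decay_euler ].

(** The value of the series at 1; decay at a rate at least 1 makes the limit exist. *)
Definition fsum (R : realType) (a : fps R) : R := limn (series a).

(** The quotient (a(x) - a(1)) / (1 - x). Its coefficient [n] is minus the tail of [a] strictly
    beyond [n], whence the shift to [n.+1]. *)
Definition taylor_rem (R : realType) (a : fps R) : fps R := fun n => series a n.+1 - fsum a.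

Section fsum.
Variables (R : realType) (s : R).
Hypothesis s1 : 1 <= s.

Let s0 : 0 <= s. Proof. exact: le_trans s1. Qed.

Lemma decay_cvg (a : fps R) : decay s a -> cvgn (series a).
Proof.
move=> /decay_at [t st [C C0 HC]]; have t1 : 1 < t := le_lt_trans s1 st.
have t0 : 0 < t by apply: lt_trans t1.
apply: normed_cvg; apply: (@series_le_cvg _ _ (geometric C t^-1)) => //.
- by move=> n /=.
- by move=> n; rewrite /geometric /= mulr_ge0// exprn_ge0// invr_ge0 ltW.
- by move=> n; rewrite /geometric /= exprVn ler_pdivlMr ?exprn_gt0.
- by apply: is_cvg_geometric_series; rewrite ger0_norm ?invr_ge0 ?ltW// invf_lt1.
Qed.

Lemma decay_cvg0 (a : fps R) : decay s a -> a @ \oo --> (0 : R).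
Proof. by move=> /decay_cvg /cvg_series_cvg_0. Qed.

Lemma fsumD (a b : fps R) : decay s a -> decay s b -> fsum (a + b) = fsum a + fsum b.
Proof. by move=> /decay_cvg ca /decay_cvg cb; rewrite -lim_seriesD. Qed.

Lemma fsumN (a : fps R) : decay s a -> fsum (- a) = - fsum a.
Proof. by move=> /decay_cvg ca; rewrite -lim_seriesN. Qed.

Lemma fsumB (a b : fps R) : decay s a -> decay s b -> fsum (a - b) = fsum a - fsum b.
Proof. by move=> da db; rewrite fsumD ?fsumN//; apply: decayN. Qed.

Lemma series_eM (w : fps R) n : series ((1 - fpsX R) * w) n.+1 = w n.
Proof.
rewrite mulrBl mul1r; elim: n => [|n IH].
  by rewrite seriesSr /series /= big_geq// add0r fpsD fpsN fpsXM0 subr0.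
by rewrite seriesSr IH fpsD fpsN fpsXMS addrC subrK.
Qed.

(** The partial sums telescope to the coefficients of [w], which tend to 0. *)
Lemma fsum_eM (w : fps R) : decay s w -> fsum ((1 - fpsX R) * w) = 0.
Proof.
move=> dw; apply/cvg_lim => //; rewrite -cvg_shiftS.
by under eq_cvg do rewrite /= series_eM; exact: decay_cvg0.
Qed.

Lemma fsumC (c : R) : fsum (fpsC c) = c.
Proof.
apply/cvg_lim => //; rewrite -cvg_shiftS; apply: cvg_near_cst; apply: nearW => n.
change (series (fpsC c) n.+1 = c); elim: n => [|n IH]; first by rewrite seriesSr /series /= big_geq// add0r.
by rewrite seriesSr IH addr0.
Qed.

Lemma taylor (a : fps R) : a = fpsC (fsum a) + (1 - fpsX R) * taylor_rem a.
Proof.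
rewrite mulrBl mul1r; apply/funext => -[|n]; rewrite !fpsD fpsN ?fpsXM0 ?fpsXMS /taylor_rem.
  by rewrite subr0 seriesSr /series /= big_geq// add0r /fpsC mulr1n addrC subrK.
rewrite [series a n.+2]seriesSr /fpsC mulr0n; ring.
Qed.

Lemma decay_taylor_rem (a : fps R) : decay s a -> decay s (taylor_rem a).
Proof.
move=> da; have ca := decay_cvg da.
have [t st [C C0 HC]] := decay_at da; have t1 : 1 < t := le_lt_trans s1 st.
have t0 : 0 < t by apply: lt_trans t1.
have t10 : 0 < t - 1 by rewrite subr_gt0.
have st0 n : 0 < t ^- n by rewrite invr_gt0 exprn_gt0.
(* The tail is compared with the geometric sum of t^-i for n < i <= n + k, in closed form; then [k]
   goes to infinity. *)
have key n k : `|series a (n.+1 + k)%N - series a n.+1| <= C / (t - 1) * (t ^- n - t ^- (n + k)).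
  elim: k => [|k IH]; first by rewrite !addn0 !subrr normr0 mulr0.
  rewrite !addnS seriesSr -addnS addrAC (le_trans (ler_normD _ _))//.
  have -> : C / (t - 1) * (t ^- n - t ^- (n + k.+1)) =
      C / (t - 1) * (t ^- n - t ^- (n + k)) + C * t ^- (n + k).+1.
    rewrite addnS exprS invfM; field.
    by rewrite !gt_eqF// ?exprn_gt0.
  by rewrite lerD// addSn ler_pdivlMr ?exprn_gt0// HC.
exists t => //; exists (C / (t - 1)) => n.
rewrite -ler_pdivlMr ?exprn_gt0//.
have cb : (fun m => `|series a (n.+1 + m)%N - series a n.+1|) @ \oo --> `|fsum a - series a n.+1|.
  apply: cvg_norm; apply: cvgB; last exact: cvg_cst.
  under eq_cvg do rewrite addnC.
  by have := ca; rewrite -(cvg_shiftn n.+1).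
rewrite /taylor_rem distrC -(cvg_lim _ cb)//.
apply: limr_le; first by apply/cvg_ex; eexists; exact: cb.
apply: nearW => m; apply: le_trans (key n m) _.
by rewrite ler_wpM2l ?divr_ge0 ?(ltW t10)// gerBl ltW.
Qed.

(** Expanding both factors at 1 writes the product as a constant plus a multiple of 1 - x, which
    vanishes at 1. No double sum has to be rearranged. *)
Lemma fsumM (a b : fps R) : decay s a -> decay s b -> fsum (a * b) = fsum a * fsum b.
Proof.
move=> da db; set A := fsum a; set B := fsum b.
have dra := decay_taylor_rem da; have drb := decay_taylor_rem db.
have -> : a * b = fpsC (A * B) + (1 - fpsX R) *
    (fpsC A * taylor_rem b + fpsC B * taylor_rem a +
     (1 - fpsX R) * taylor_rem a * taylor_rem b).
  rewrite {1}(taylor a) {1}(taylor b) -/A -/B fpsC_mul; ring.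
have dX : decay s (1 - fpsX R) by decay_closed.
have dr : decay s (fpsC A * taylor_rem b + fpsC B * taylor_rem a +
     (1 - fpsX R) * taylor_rem a * taylor_rem b).
  by decay_closed.
rewrite fsumD ?fsum_eM ?fsumC ?addr0//; first exact: decayC.
exact: decayM.
Qed.

End fsum.

(** * Moments and the Leibniz rule *)

Definition mom (R : realType) (i : nat) (a : fps R) : R := fsum (iter i (@euler R) a).

Section moments.
Variables (R : realType) (s : R).
Hypothesis s1 : 1 <= s.

Let s0 : 0 <= s. Proof. exact: le_trans s1. Qed.
Local Notation e := (1 - fpsX R).

Lemma decay_e : decay s e.
Proof. by decay_closed. Qed.

Lemma decay_iter_euler (a : fps R) i : decay s a -> decay s (iter i (@euler R) a).
Proof. by move=> da; elim: i => //= i IH; apply: decay_euler. Qed.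

Lemma momD i (a b : fps R) : decay s a -> decay s b -> mom i (a + b) = mom i a + mom i b.
Proof.
move=> da db; rewrite /mom -(fsumD s1); try exact: decay_iter_euler.
by congr fsum; elim: i => //= i ->; rewrite eulerD.
Qed.

Lemma momN i (a : fps R) : decay s a -> mom i (- a) = - mom i a.
Proof.
move=> da; rewrite /mom -(fsumN s1); try exact: decay_iter_euler.
by congr fsum; elim: i => //= i ->; rewrite eulerN.
Qed.

Lemma mom0M (a b : fps R) : decay s a -> decay s b -> mom 0 (a * b) = mom 0 a * mom 0 b.
Proof. exact: fsumM. Qed.

Lemma mom1M (a b : fps R) : decay s a -> decay s b ->
  mom 1 (a * b) = mom 1 a * mom 0 b + mom 0 a * mom 1 b.
Proof.
move=> da db; rewrite /mom /= eulerM (fsumD s1) ?(fsumM s1)//; by decay_closed.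
Qed.

Lemma mom2M (a b : fps R) : decay s a -> decay s b ->
  mom 2 (a * b) = mom 2 a * mom 0 b + 2 * (mom 1 a * mom 1 b) + mom 0 a * mom 2 b.
Proof.
move=> da db; have da1 := decay_euler s0 da; have db1 := decay_euler s0 db.
rewrite {1}/mom /= eulerM eulerD (fsumD s1); try by decay_closed.
rewrite -![fsum (euler _)]/(mom 1 _) !mom1M// /mom /=; ring.
Qed.

(** Order three is needed because [mom 0 f] will vanish: in [f * g = 1 - fpsX R] the second moment
    of [g] is then determined only at this order. *)
Lemma mom3M (a b : fps R) : decay s a -> decay s b ->
  mom 3 (a * b) = mom 3 a * mom 0 b + 3 * (mom 2 a * mom 1 b) +
                  3 * (mom 1 a * mom 2 b) + mom 0 a * mom 3 b.
Proof.
move=> da db; have da1 := decay_euler s0 da; have db1 := decay_euler s0 db.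
rewrite {1}/mom /= eulerM !eulerD (fsumD s1); try by decay_closed.
rewrite -![fsum (euler (euler _))]/(mom 2 _) !mom2M// /mom /=; ring.
Qed.

Lemma euler_fpsC (c : R) : euler (fpsC c) = 0.
Proof. by apply/funext => -[|n]; rewrite /euler /fpsC (mul0r, mulr0). Qed.

Lemma mom0e : mom 0 e = 0.
Proof. by rewrite -[e]mulr1; apply: (fsum_eM s1); decay_closed. Qed.

Lemma mom0X : mom 0 (fpsX R) = 1.
Proof.
have -> : fpsX R = fpsC 1 - e by rewrite fpsC1; ring.
by rewrite /mom /= (fsumB s1) ?fsumC ?[fsum e]mom0e ?subr0//; decay_closed.
Qed.

(** The derivation sends 1 - x to -x and fixes x, whose value at 1 is 1. *)
Lemma momSe i : mom i.+1 e = -1.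
Proof.
rewrite -mom0X -(momN 0); last exact: decayX.
congr fsum; elim: i => [|i IH] /=; first by rewrite eulerD eulerN euler1 eulerX add0r.
by rewrite -/(iter i.+1 (@euler R) e) IH eulerN eulerX.
Qed.

(** The Leibniz rule is applied to the product in [taylor]: the constant has no higher moments, and
    [e] has moments 0, -1, -1. *)
Lemma mom_taylor_rem (a : fps R) : decay s a ->
  mom 1 a = - mom 0 (taylor_rem a) /\
  mom 2 a = - mom 0 (taylor_rem a) - 2 * mom 1 (taylor_rem a).
Proof.
move=> da; have dr := decay_taylor_rem s1 da; have de := decay_e.
have dC : decay s (fpsC (fsum a)) by decay_closed.
have mC i : mom i.+1 (fpsC (fsum a)) = 0.
  rewrite /mom iterSr euler_fpsC.
  have -> : iter i (@euler R) 0 = fpsC 0.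
    elim: i => /= [|i ->]; first by apply/funext => n; rewrite /fpsC mul0rn.
    by rewrite euler_fpsC; apply/funext => n; rewrite /fpsC mul0rn.
  exact: fsumC.
have der := decayM s0 de dr.
have aE i : mom i a = mom i (fpsC (fsum a)) + mom i (e * taylor_rem a).
  by rewrite -momD// -taylor.
by rewrite !aE !mC mom1M// mom2M// mom0e !momSe; split; ring.
Qed.

(** * Coefficients at poles of order one, two and three *)

Lemma geom1V : e * geom 1 = 1 :> fps R.
Proof. by have := geomV (1 : R); rewrite fpsC1 mul1r. Qed.

Lemma eM_inj (a b : fps R) : e * a = e * b -> a = b.
Proof.
by move=> ab; rewrite -[a]mul1r -[b]mul1r -geom1V ![e * geom 1]mulrC -!mulrA ab.
Qed.

Lemma geom_sqE n : (geom 1 * geom 1) n = n.+1%:R :> R.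
Proof.
have -> // : geom 1 * geom 1 = (fun n => n.+1%:R) :> fps R.
apply: eM_inj; rewrite mulrA geom1V mul1r mulrBl mul1r.
apply/funext => -[|k]; rewrite fpsD fpsN ?fpsXM0 ?fpsXMS /geom expr1n ?subr0//.
by rewrite -[k.+2%:R]natr1 addrC addrA addNr add0r.
Qed.

Lemma geom_cubE n : (geom 1 * geom 1 * geom 1) n = n.+1%:R * n.+2%:R / 2 :> R.
Proof.
have -> // : geom 1 * geom 1 * geom 1 = (fun n => n.+1%:R * n.+2%:R / 2) :> fps R.
apply: eM_inj; rewrite !mulrA geom1V mul1r mulrBl mul1r.
apply/funext => -[|k]; rewrite fpsD fpsN ?fpsXM0 ?fpsXMS geom_sqE.
  by rewrite subr0 mul1r divff.
by rewrite -[k.+3%:R]natr1 -[k.+2%:R]natr1; field.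
Qed.

(** Dividing h = h(1) + (1 - x) h' by 1 - x leaves h(1) / (1 - x), with constant coefficients, and
    the decaying error h'. *)
Lemma pole1 (u h : fps R) : e * u = h -> decay s h ->
  exists2 w, decay s w & forall n, u n = mom 0 h + w n.
Proof.
move=> uh dh; exists (taylor_rem h); first exact: decay_taylor_rem.
have -> : u = fpsC (mom 0 h) * geom 1 + taylor_rem h.
  apply: eM_inj; rewrite uh.
  have -> : e * (fpsC (mom 0 h) * geom 1 + taylor_rem h) =
      fpsC (mom 0 h) * (e * geom 1) + e * taylor_rem h by ring.
  by rewrite geom1V mulr1 -taylor.
by move=> n; rewrite fpsD fpsCM /geom expr1n mulr1.
Qed.

(** Subtracting h(1) / (1 - x)^2, with coefficients h(1) (n + 1), leaves a simple pole with
    numerator [taylor_rem h]. *)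
Lemma pole2 (u h : fps R) : e * (e * u) = h -> decay s h ->
  exists2 w, decay s w & forall n, u n = mom 0 h * n.+1%:R - mom 1 h + w n.
Proof.
move=> uh dh; pose v := u - fpsC (mom 0 h) * (geom 1 * geom 1).
have ev : e * v = taylor_rem h.
  apply: eM_inj; rewrite /v.
  have -> : e * (e * (u - fpsC (mom 0 h) * (geom 1 * geom 1))) =
      e * (e * u) - fpsC (mom 0 h) * ((e * geom 1) * (e * geom 1)) by ring.
  by rewrite uh {1}(taylor h) geom1V !mulr1 addrAC subrr add0r.
have [w dw vw] := pole1 ev (decay_taylor_rem s1 dh); exists w => // n.
have -> : u = v + fpsC (mom 0 h) * (geom 1 * geom 1) by rewrite /v subrK.
rewrite fpsD fpsCM geom_sqE vw; have [-> _] := mom_taylor_rem dh; ring.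
Qed.

(** Subtracting h(1) / (1 - x)^3 reduces to a double pole with numerator [taylor_rem h], whose
    moments are then traded for those of [h]. *)
Lemma pole3 (u h : fps R) : e * (e * (e * u)) = h -> decay s h ->
  exists2 w, decay s w & forall n,
    u n = (mom 0 h * n.+1%:R * n.+2%:R - mom 1 h * (2 * n%:R + 3) + mom 2 h) / 2 + w n.
Proof.
move=> uh dh; pose v := u - fpsC (mom 0 h) * (geom 1 * geom 1 * geom 1).
have ev : e * (e * v) = taylor_rem h.
  apply: eM_inj; rewrite /v.
  have -> : e * (e * (e * (u - fpsC (mom 0 h) * (geom 1 * geom 1 * geom 1)))) =
      e * (e * (e * u)) -
      fpsC (mom 0 h) * ((e * geom 1) * (e * geom 1) * (e * geom 1)) by ring.
  by rewrite uh {1}(taylor h) geom1V !mulr1 addrAC subrr add0r.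
have [w dw vw] := pole2 ev (decay_taylor_rem s1 dh); exists w => // n.
have -> : u = v + fpsC (mom 0 h) * (geom 1 * geom 1 * geom 1) by rewrite /v subrK.
rewrite fpsD fpsCM geom_cubE vw; have [-> ->] := mom_taylor_rem dh.
by rewrite -[n.+2%:R]natr1 -[n.+1%:R]natr1; field.
Qed.

End moments.

(** * Variance from pole expansions *)

(** Here [x] stands for n and [d] bounds the errors. As [a] and [b] may grow like x and x^2, the
    errors are amplified by at most x^2; [d <= g0 / 2] keeps the denominator away from 0. *)
Lemma var_perturb (R : realType) (g0 A x d a b w0 w1 w2 : R) :
  0 < g0 -> 0 <= A -> 1 <= x -> 0 <= d -> d <= 1 -> d <= g0 / 2 ->
  `|a| <= A * x -> `|b| <= A * x ^+ 2 -> `|w0| <= d -> `|w1| <= d -> `|w2| <= d ->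
  `|(b + w2) / (g0 + w0) - ((a + w1) / (g0 + w0)) ^+ 2 - (b / g0 - (a / g0) ^+ 2)| <=
  2 * (g0 + A) / g0 ^+ 2 * (1 + (3 * A + 2) / g0) * (x ^+ 2 * d).
Proof.
move=> g00 A0 x1 d0 d1 dg ha hb h0 h1 h2; set c := g0 + w0.
have x0 : 0 <= x by lra.
have xx : x <= x ^+ 2 by rewrite expr2 ler_peMl.
have x21 : 1 <= x ^+ 2 by lra.
have cg : g0 / 2 <= c by move: h0; rewrite /c ler_norml; lra.
have c0 : 0 < c by lra.
(* The two squares are combined as a difference times a sum; the difference is of order x d and the
   sum of order x. *)
have -> : (b + w2) / c - ((a + w1) / c) ^+ 2 - (b / g0 - (a / g0) ^+ 2) =
  (g0 * w2 - b * w0) / (g0 * c) - (g0 * w1 - a * w0) / (g0 * c) * ((a + w1) / c + a / g0).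
  by rewrite /c; field; rewrite -/c !gt_eqF.
have gc : (g0 * c)^-1 <= 2 / g0 ^+ 2.
  rewrite -[leRHS]invrK invf_div lef_pV2 ?posrE ?divr_gt0 ?mulr_gt0 ?exprn_gt0//.
  by rewrite expr2 -mulrA ler_pM2l.
have cV : c^-1 <= 2 / g0 by rewrite -[leRHS]invrK invf_div lef_pV2 ?posrE ?divr_gt0.
have gc0 : 0 <= (g0 * c)^-1 by rewrite invr_ge0 mulr_ge0// ltW.
have cV0 : 0 <= c^-1 by rewrite invr_ge0 ltW.
have t1 : `|(g0 * w2 - b * w0) / (g0 * c)| <= (g0 + A) * (x ^+ 2 * d) * (2 / g0 ^+ 2).
  rewrite normrM (ger0_norm gc0) ler_pM// (le_trans (ler_normB _ _))// !normrM (gtr0_norm g00).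
  have k1 : g0 * `|w2| <= g0 * (x ^+ 2 * d).
    by rewrite ler_pM2l// (le_trans h2)// ler_peMl.
  have k2 : `|b| * `|w0| <= A * x ^+ 2 * d by apply: ler_pM.
  by lra.
have t2 : `|(g0 * w1 - a * w0) / (g0 * c)| <= (g0 + A) * (x * d) * (2 / g0 ^+ 2).
  rewrite normrM (ger0_norm gc0) ler_pM// (le_trans (ler_normB _ _))// !normrM (gtr0_norm g00).
  have k1 : g0 * `|w1| <= g0 * (x * d).
    by rewrite ler_pM2l// (le_trans h1)// ler_peMl.
  have k2 : `|a| * `|w0| <= A * x * d by apply: ler_pM.
  by lra.
have t3 : `|(a + w1) / c + a / g0| <= (3 * A + 2) / g0 * x.
  have k1 : `|(a + w1) / c| <= (A + 1) * x * (2 / g0).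
    rewrite normrM (ger0_norm cV0) ler_pM// (le_trans (ler_normD _ _))//; lra.
  have k2 : `|a / g0| <= A * x / g0.
    by rewrite normrM normfV (gtr0_norm g00) ler_pM2r// invr_gt0.
  apply: le_trans (ler_normD _ _) _; apply: le_trans (lerD k1 k2) _.
  by rewrite le_eqVlt; apply/orP; left; apply/eqP; field; rewrite gt_eqF.
apply: le_trans (ler_normB _ _) _; rewrite [X in _ + X]normrM.
apply: le_trans (lerD t1 (ler_pM (normr_ge0 _) (normr_ge0 _) t2 t3)) _.
by rewrite le_eqVlt; apply/orP; left; apply/eqP; field; rewrite gt_eqF.
Qed.

Lemma decay_bound (R : realType) (s : R) (a : fps R) : 0 < s -> decay s a ->
  exists2 C, 0 <= C & forall n, `|a n| <= C * s^-1 ^+ n.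
Proof.
move=> s0 /decay_at [t st [C C0 HC]]; exists C => // n.
by rewrite exprVn ler_pdivlMr ?exprn_gt0// (decay_shrink (ltW s0) (ltW st)).
Qed.

(* The pole expansions of c, m1, m2 at 1; the quadratic growth of the second
   moment cancels in the variance. *)
Theorem variance_asymptotics (R : realType) (s : R) (f l l2 c m1 m2 : fps R) :
  1 < s -> decay s f -> decay s l -> decay s l2 -> decay s ((1 - fpsX R) * c) ->
  f * c = 1 -> f * m1 = l * c -> f * m2 = l2 * c + l * m1 *+ 2 ->
  mom 0 f = 0 -> mom 1 f < 0 ->
  let K := - mom 1 f in let K2 := - mom 2 f in let K3 := - mom 3 f in
  let L := mom 0 l in let KL := mom 1 l in let K2L := mom 2 l in
  let L2 := mom 0 l2 in let KL2 := mom 1 l2 in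
  let b1 := L ^+ 2 * K2 / K ^+ 3 - 2 * L * KL / K ^+ 2 + L2 / K in
  let b0 := 2 * L ^+ 2 * K2 ^+ 2 / K ^+ 4
    - (L ^+ 2 * K3 + 4 * L * KL * K2) / K ^+ 3
    + (KL ^+ 2 + L2 * K2 + 2 * L * K2L) / K ^+ 2
    - KL2 / K in
  exists C, \forall n \near \oo, 0 < c n /\
    `|m2 n / c n - (m1 n / c n) ^+ 2 - (b1 * n%:R + b0)| <= C * (n%:R ^+ 2 * s^-1 ^+ n).
Proof.
move=> s_gt1 df dl dl2 dg fc fm1 fm2 f0 f1 K K2 K3 L KL K2L L2 KL2 b1 b0.
have s1 : 1 <= s := ltW s_gt1; have s0 : 0 <= s := le_trans ler01 s1.
have K0 : 0 < K by rewrite /K oppr_gt0.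
have de := decay_e s1.
(* Multiplying [c] by [e] cancels its pole at 1; [g] is the decaying cofactor, with [f * g = e]. *)
set e := 1 - fpsX R in dg de; set g := e * c in dg.
have fg : f * g = e by rewrite /g mulrCA fc mulr1.
have m1E : m1 = l * c * c by rewrite -fm1 mulrAC fc mul1r.
have m2E : m2 = l2 * c * c + (l * l * c * c * c) *+ 2.
  have -> : m2 = f * m2 * c by rewrite mulrAC fc mul1r.
  by rewrite fm2 m1E; ring.
have em1 : e * (e * m1) = l * (g * g) by rewrite m1E /g; ring.
(* The part [l2 * c * c] has only a double pole, so clearing a triple one leaves it a spare factor
   [e]. *)
have em2 : e * (e * (e * m2)) = l2 * e * (g * g) + (l * l) * (g * (g * g)) + (l * l) * (g * (g * g)).
  by rewrite m2E /g; ring.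
have ec : e * c = g by []; clearbody g.
have dgg : decay s (g * g) by decay_closed.
have dggg : decay s (g * (g * g)) by decay_closed.
have dll : decay s (l * l) by decay_closed.
have dl2e : decay s (l2 * e) by decay_closed.
have dllg : decay s (l * l * (g * (g * g))) by decay_closed.
have dleg : decay s (l2 * e * (g * g)) by decay_closed.
have dleg' : decay s (l2 * e * (g * g) + l * l * (g * (g * g))) by decay_closed.
have [w0 dw0 cE] := pole1 s1 ec dg.
have [w1 dw1 m1n] := pole2 s1 em1 (decayM s0 dl dgg).
have [w2 dw2 m2n] := pole3 s1 em2 (decayD s0 dleg' dllg).
have e0 : mom 0 e = 0 := mom0e s1.
have eS i : mom i.+1 e = -1 := momSe s1 i.
(* Since [mom 0 f] is 0, the Leibniz rule of order i + 1 for [f * g = e] gives the moment of order i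
   of [g] from the lower ones; this is done for i = 0, 1, 2. *)
have g0E : mom 0 g = K^-1.
  have := mom1M s1 df dg; rewrite fg eS f0 mul0r addr0 => H.
  by apply: (mulfI (lt0r_neq0 K0)); rewrite divff ?lt0r_neq0// /K mulNr -H opprK.
have g1E : mom 1 g = (1 - K2 / K) / (2 * K).
  have := mom2M s1 df dg; rewrite fg eS f0 mul0r addr0 g0E => H.
  apply: (mulfI (lt0r_neq0 K0)); transitivity ((1 - K2 / K) / 2).
    by rewrite /K /K2 in H *; lra.
  by field; rewrite lt0r_neq0.
have g2E : mom 2 g = (1 - K3 / K - 3 * (K2 * mom 1 g)) / (3 * K).
  have := mom3M s1 df dg; rewrite fg eS f0 mul0r addr0 g0E => H.
  apply: (mulfI (lt0r_neq0 K0)); transitivity ((1 - K3 / K - 3 * (K2 * mom 1 g)) / 3).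
    by rewrite /K /K2 /K3 in H *; lra.
  by field; rewrite lt0r_neq0.
rewrite !(momD s1)// in m2n.
rewrite !(mom0M s1, mom1M s1, mom2M s1)// in m1n m2n.
rewrite e0 !eS -/L -/KL -/K2L -/L2 -/KL2 in m1n m2n.
pose a n := m1 n - w1 n; pose b n := m2 n - w2 n.
(* With the decaying errors removed, the terms in n^2 cancel and the variance is exactly linear;
   [b1] and [b0] come from this identity. *)
have abE n : b n / K^-1 - (a n / K^-1) ^+ 2 = b1 * n%:R + b0.
  rewrite /a /b m1n m2n !addrK g2E g1E g0E /b1 /b0 -[n.+2%:R]natr1 -[n.+1%:R]natr1.
  by field; rewrite lt0r_neq0.
have [A1 aA] : exists A, forall n, (0 < n)%N -> `|a n| <= A * n%:R.
  have [x [y xy]] : exists x y, forall n, a n = x * n%:R + y.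
    by eexists; eexists => n; rewrite /a m1n addrK -natr1 mulrDr mulr1 -addrA.
  exists (`|x| + `|y|) => n n0; rewrite xy mulrDl (le_trans (ler_normD _ _))//.
  by rewrite normrM normr_nat lerD2l ler_peMr// ler1n.
have [A2 bA] : exists A, forall n, (0 < n)%N -> `|b n| <= A * n%:R ^+ 2.
  have [x [y [z xyz]]] : exists x y z, forall n, b n = x * n%:R ^+ 2 + y * n%:R + z.
    eexists; eexists; eexists => n; rewrite /b m2n addrK -[n.+2%:R]natr1 -[n.+1%:R]natr1.
    (* The coefficients are named so that the quadratic can be regrouped by powers of n;
       [reflexivity] then fixes the witnesses. *)
    set B0 := (X in X * (_ + 1) * _); set B1 := (X in X * (2 * _ + 3)).
    set B2 := (X in (_ - _ + X) / 2).
    transitivity (B0 / 2 * n%:R ^+ 2 + (B0 * 3 / 2 - B1) * n%:R + (B0 - B1 * 3 / 2 + B2 / 2)).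
      by field.
    reflexivity.
  exists (`|x| + `|y| + `|z|) => n n0.
  have n1 : 1 <= n%:R :> R by rewrite ler1n.
  have nn : n%:R <= n%:R ^+ 2 :> R by rewrite expr2 ler_peMl.
  have n21 : 1 <= n%:R ^+ 2 :> R by apply: le_trans nn.
  have k1 : `|x * n%:R ^+ 2| <= `|x| * n%:R ^+ 2 by rewrite normrM normrX normr_nat.
  have k2 : `|y * n%:R| <= `|y| * n%:R ^+ 2 by rewrite normrM normr_nat ler_wpM2l.
  have k3 : `|z| <= `|z| * n%:R ^+ 2 by rewrite ler_peMr.
  rewrite xyz !mulrDl (le_trans (ler_normD _ _))// lerD//.
  by rewrite (le_trans (ler_normD _ _))// lerD.
pose A := `|A1| + `|A2|.
have [C0 C00 HC0] := decay_bound (lt_le_trans ltr01 s1) dw0.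
have [C1 C10 HC1] := decay_bound (lt_le_trans ltr01 s1) dw1.
have [C2 C20 HC2] := decay_bound (lt_le_trans ltr01 s1) dw2.
pose C := C0 + C1 + C2; pose d n := C * s^-1 ^+ n.
have sV0 n : 0 <= s^-1 ^+ n by rewrite exprn_ge0// invr_ge0.
have dC D n : D <= C -> D * s^-1 ^+ n <= d n by move=> DC; rewrite ler_wpM2r.
have dcvg : d @ \oo --> (0 : R).
  by apply: (@cvg_geometric R C s^-1); rewrite ger0_norm ?invr_ge0// invf_lt1// (lt_le_trans ltr01).
have KV0 : 0 < K^-1 by rewrite invr_gt0.
exists (2 * (K^-1 + A) / K^-1 ^+ 2 * (1 + (3 * A + 2) / K^-1) * C).
near=> n.
have n0 : (0 < n)%N by near: n; exact: nbhs_infty_gt.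
have n1 : 1 <= n%:R :> R by rewrite ler1n.
have d0 : 0 <= d n by rewrite mulr_ge0// !addr_ge0.
(* For large n the common error bound meets the two smallness conditions of [var_perturb]. *)
have dmin : d n < Num.min 1 (K^-1 / 2).
  by near: n; apply: (cvgr_lt 0) => //; rewrite lt_min ltr01 divr_gt0.
have [d1 dK] : d n <= 1 /\ d n <= K^-1 / 2.
  by move: dmin; rewrite lt_min => /andP[/ltW ? /ltW ?].
have [h0 h1 h2] : [/\ `|w0 n| <= d n, `|w1 n| <= d n & `|w2 n| <= d n].
  split; [apply: le_trans (HC0 n) _|apply: le_trans (HC1 n) _|apply: le_trans (HC2 n) _];
    by apply: dC; rewrite /C; lra.
have ha : `|a n| <= A * n%:R.
  apply: le_trans (aA n n0) _; rewrite ler_wpM2r// /A.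
  by rewrite (le_trans (ler_norm _))// lerDl.
have hb : `|b n| <= A * n%:R ^+ 2.
  apply: le_trans (bA n n0) _; rewrite ler_wpM2r ?exprn_ge0// /A.
  by rewrite (le_trans (ler_norm _))// lerDr.
have A0 : 0 <= A by rewrite addr_ge0.
have cn : c n = K^-1 + w0 n by rewrite cE g0E.
split.
  by rewrite cn; move: h0; rewrite ler_norml; lra.
have := var_perturb KV0 A0 n1 d0 d1 dK ha hb h0 h1 h2.
rewrite abE -cn /a /b !subrK => /le_trans; apply.
by rewrite -[leRHS]mulrA /d [C * (_ * _)]mulrCA.
Unshelve. all: by end_near. Qed.

(** * Generating functions of compositions *)

(* [m] is fuel: the value does not depend on it as long as [n <= m]. *)
Fixpoint comps (S : set nat) (m n : nat) : seq (seq nat) :=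
  if n is 0%N then [:: [::]] else
  if m is m'.+1 then
    [seq k :: t | k <- [seq k <- iota 1 n | k \in S], t <- comps S m' (n - k)]
  else [::].

Lemma compsS (S : set nat) m n : comps S m.+1 n.+1 =
  [seq k :: t | k <- [seq k <- iota 1 n.+1 | k \in S], t <- comps S m (n.+1 - k)].
Proof. by []. Qed.

Section compositions.
Variable S : set nat.
Hypothesis S_gt0 : S `<=` [set k | (0 < k)%N].

(** As parts are positive, a sum 0 admits only the empty sequence, and removing the first part
    lowers the sum, so the fuel lasts. *)
Lemma mem_comps m n t : (n <= m)%N -> t \in comps S m n <-> compositions S n t.
Proof.
elim: m n t => [|m IH] [|n] t // nm; rewrite ?compsS ?mem_seq1.
- split=> [/eqP ->//|[tS t0]]; case: t tS t0 => // k t tS /= /eqP.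
  by rewrite addn_eq0 => /andP[/eqP k0 _]; have := S_gt0 (tS k (mem_head _ _)); rewrite k0.
- split=> [/eqP ->//|[tS t0]]; case: t tS t0 => // k t tS /= /eqP.
  by rewrite addn_eq0 => /andP[/eqP k0 _]; have := S_gt0 (tS k (mem_head _ _)); rewrite k0.
split=> [/allpairsPdep [k [t' [+ + ->]]]|[]].
  rewrite mem_filter mem_iota => /and3P[/set_mem kS k0 kn] /IH [|t'S t'E].
    by rewrite leq_subLR; move: nm; lia.
  split => [j|/=]; last by rewrite t'E subnKC.
  by rewrite in_cons => /orP[/eqP ->|/t'S].
case: t => // k t tS tE; rewrite /= in tE; apply/allpairsPdep; exists k, t.
have kS : S k by apply: tS; rewrite mem_head.
have k0 := S_gt0 kS; rewrite /= in k0.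
split => //; first by rewrite mem_filter mem_iota; apply/and3P; split; [exact: mem_set|exact: k0|lia].
apply/IH; first by lia.
by split => [j jt|]; [apply: tS; rewrite in_cons jt orbT|lia].
Qed.

Lemma uniq_comps m n : uniq (comps S m n).
Proof.
elim: m n => [|m IH] [|n] //; rewrite compsS; apply: allpairs_uniq_dep => //.
  by rewrite filter_uniq ?iota_uniq.
by move=> [k t] [k' t'] _ _ /= [-> ->].
Qed.

Lemma perm_comps m n : (n <= m)%N -> perm_eq (comps S m n) (comps S n n).
Proof.
move=> nm; apply: uniq_perm; rewrite ?uniq_comps// => t.
by apply/idP/idP => /mem_comps tS; apply/mem_comps => //; apply: tS.
Qed.

Lemma compositionsE n : compositions S n = [set` comps S n n].
Proof. by apply/seteqP; split => t /mem_comps; apply. Qed.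

Variable R : realType.

Definition wsum (F : seq nat -> R) : fps R := fun n => \sum_(t <- comps S n n) F t.

Definition indS (u : nat -> R) : fps R := fun k => if k \in S then u k else 0.

Lemma indS0 u : indS u 0 = 0.
Proof. by rewrite /indS; case: ifPn => //; rewrite inE => /S_gt0. Qed.

Lemma wsum0 F : wsum F 0 = F [::].
Proof. by rewrite /wsum big_seq1. Qed.

(** Splitting off the first part [k]; with [indSMS] this becomes a product by a series supported on
    [S]. *)
Lemma wsumS F n : wsum F n.+1 =
  \sum_(k <- iota 1 n.+1 | k \in S) wsum (fun t => F (k :: t)) (n.+1 - k)%N.
Proof.
rewrite /wsum compsS big_allpairs_dep big_filter big_seq_cond [RHS]big_seq_cond.
apply: eq_bigr => k /andP[]; rewrite mem_iota => /andP[k0 kn] _.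
by apply: perm_big; apply: perm_comps; lia.
Qed.

Lemma indSM0 u (a : fps R) : (indS u * a) 0 = 0.
Proof. by rewrite fpsM big_ord1 indS0 mul0r. Qed.

Lemma indSMS u (a : fps R) n :
  (indS u * a) n.+1 = \sum_(k <- iota 1 n.+1 | k \in S) u k * a (n.+1 - k)%N.
Proof.
rewrite fpsM -(big_mkord xpredT (fun i => indS u i * a (n.+1 - i)%N)) big_ltn//.
rewrite indS0 mul0r add0r [RHS]big_mkcond /index_iota subn1; apply: eq_bigr => k _.
by rewrite /indS; case: ifP => //; rewrite mul0r.
Qed.

Lemma wsumD F G : wsum (fun t => F t + G t) = wsum F + wsum G.
Proof. by apply/funext => n; rewrite /wsum big_split. Qed.

Lemma wsumZ a F n : wsum (fun t => a * F t) n = a * wsum F n.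
Proof. by rewrite /wsum mulr_sumr. Qed.

Lemma eq_wsum F G n : (forall t, compositions S n t -> F t = G t) -> wsum F n = wsum G n.
Proof.
move=> FG; rewrite /wsum big_seq_cond [RHS]big_seq_cond; apply: eq_bigr => t.
by rewrite andbT => /mem_comps tS; apply/FG/tS.
Qed.

Lemma logB_cons k t n : S k -> compositions S n t -> @logB R (k :: t) = ln k%:R + @logB R t.
Proof.
move=> kS [tS _]; rewrite /logB /partprod big_cons natrM lnM ?posrE// ltr0n; first exact: S_gt0.
by rewrite big_seq_cond prodn_cond_gt0// => j; rewrite andbT => /tS /S_gt0.
Qed.

Definition c_fps : fps R := wsum (fun=> 1).
Definition m1_fps : fps R := wsum (@logB R).
Definition m2_fps : fps R := wsum (fun t => @logB R t ^+ 2).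
Definition f_fps : fps R := 1 - indS (fun=> 1).
Definition l_fps : fps R := indS (fun k => ln k%:R).
Definition l2_fps : fps R := indS (fun k => ln k%:R ^+ 2).

(** A composition is empty or a first part followed by a composition: c = 1 + (1 - f) c. *)
Lemma c_fpsE : f_fps * c_fps = 1.
Proof.
rewrite /f_fps mulrBl mul1r; apply/funext => -[|n]; rewrite fpsD fpsN.
  by rewrite indSM0 subr0 /c_fps wsum0.
by rewrite indSMS /c_fps wsumS; under [X in _ - X]eq_bigr do rewrite mul1r; rewrite subrr.
Qed.

Lemma logB0 : @logB R [::] = 0.
Proof. by rewrite /logB /partprod big_nil ln1. Qed.

(** Additivity of log B along the first part gives m1 = l c + (1 - f) m1. *)
Lemma m1_fpsE : f_fps * m1_fps = l_fps * c_fps.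
Proof.
rewrite /f_fps mulrBl mul1r; apply/funext => -[|n]; rewrite fpsD fpsN.
  by rewrite !indSM0 subr0 /m1_fps wsum0 logB0.
rewrite !indSMS {1}/m1_fps wsumS -sumrB; apply: eq_bigr => k; rewrite inE => kS.
rewrite (@eq_wsum _ (fun t => ln k%:R * 1 + @logB R t)); last first.
  by move=> t tS; rewrite (logB_cons kS tS) mulr1.
by rewrite wsumD fpsD wsumZ mul1r addrK.
Qed.

(** The square of ln k + log B contributes l2 c, the cross term 2 l m1, and (1 - f) m2. *)
Lemma m2_fpsE : f_fps * m2_fps = l2_fps * c_fps + l_fps * m1_fps *+ 2.
Proof.
rewrite /f_fps mulrBl mul1r; apply/funext => -[|n]; rewrite !fpsD fpsN fps_muln.
  by rewrite !indSM0 subr0 /m2_fps wsum0 logB0 expr0n mul0rn addr0.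
rewrite !indSMS {1}/m2_fps wsumS -sumrB -sumrMnl -big_split; apply: eq_bigr => k.
rewrite inE => kS /=.
rewrite (@eq_wsum _ (fun t => ln k%:R ^+ 2 * 1 + (2 * ln k%:R * @logB R t + @logB R t ^+ 2))); last first.
  by move=> t tS; rewrite (logB_cons kS tS); ring.
by rewrite !wsumD !fpsD !wsumZ mul1r addrA addrK -mulrA mulr_natl.
Qed.

Lemma unif_meanE n X : unif_mean (compositions S n) X = wsum X n / c_fps n.
Proof.
have fin : finite_set (compositions S n) by rewrite compositionsE; exact: finite_seq.
have wE (F : seq nat -> R) : \sum_(t \in compositions S n) F t = wsum F n.
  by rewrite compositionsE -fsbig_seq// uniq_comps.
rewrite /unif_mean wE; congr (_ / _).
by rewrite /c_fps -wE fsbig_finite//= card_fset_sum1 natr_sum.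
Qed.

Lemma unif_varE n : c_fps n != 0 -> unif_var (compositions S n) (@logB R) =
  m2_fps n / c_fps n - (m1_fps n / c_fps n) ^+ 2.
Proof.
move=> c0; rewrite /unif_var !unif_meanE -/m1_fps; set mu := m1_fps n / c_fps n.
have -> : wsum (fun t => (@logB R t - mu) ^+ 2) n =
    m2_fps n - 2 * mu * m1_fps n + mu ^+ 2 * c_fps n.
  rewrite (@eq_wsum _ (fun t => @logB R t ^+ 2 + ((- (2 * mu)) * @logB R t + mu ^+ 2 * 1))).
    by rewrite !wsumD !fpsD !wsumZ mulNr addrA.
  by move=> t _; ring.
by rewrite /mu; field.
Qed.

End compositions.

(** * Zeros of f *)

Section fsum_more.
Variable R : realType.

Lemma fsum_gt0 (s : R) (a : fps R) k : 1 <= s -> decay s a ->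
  (forall n, 0 <= a n) -> 0 < a k -> 0 < fsum a.
Proof.
move=> s1 da a0 ak; apply: lt_le_trans ak _; apply: limr_ge; first exact: decay_cvg da.
exists k.+1 => // n /= kn; rewrite /series /= (bigD1_seq k) ?iota_uniq ?mem_index_iota//=.
by rewrite lerDl sumr_ge0.
Qed.

Lemma fsum_scale_poly (x : R) (P : {poly R}) : fsum (scale x (fps_poly P)) = P.[x].
Proof.
apply/cvg_lim => //; apply: cvg_near_cst; exists (size P) => // n /= Pn.
rewrite /series /= big_mkord (horner_coef_wide _ Pn).
by apply: eq_bigr => i _.
Qed.

Lemma decay_scale_poly (s x : R) (P : {poly R}) : 0 <= s -> decay s (scale x (fps_poly P)).
Proof.
move=> s0; apply: (@decay_finite _ _ s0 _ (size P)) => n Pn.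
by rewrite /scale /fps_poly nth_default// mul0r.
Qed.

Lemma iter_eulerE i (a : fps R) n : iter i (@euler R) a n = n%:R ^+ i * a n.
Proof. by elim: i => [|i IH] /=; rewrite ?mul1r// /euler IH exprS mulrA. Qed.

(** Identifies the sums over [S] in the formulas for the constants with moments at 1 of rescaled
    series. *)
Lemma momentE (S : set nat) (p : R) i j :
  moment S p i j = mom i (scale p (indS S (fun k => ln k%:R ^+ j))).
Proof.
rewrite /moment /sumS /mom /fsum /series /=; congr (limn _); apply/funext => n.
rewrite big_mkcond; apply: eq_bigr => k _; rewrite iter_eulerE /scale /indS.
by case: ifP => _; rewrite ?mul0r ?mulr0// mulrA.
Qed.

Lemma momS1 i : mom i.+1 (1 : fps R) = 0.
Proof.
apply/cvg_lim => //; apply: cvg_near_cst; apply: nearW => n.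
rewrite /series /= big1// => -[|k] _; first by rewrite -/(iter i.+1 _ _) iter_eulerE exprS !mul0r.
by rewrite -/(iter i.+1 _ _) iter_eulerE fps1 mulr0.
Qed.

(** The coefficients are dominated by n^i |p|^n, those of an iterated derivative of a geometric
    series. *)
Lemma decay_scale_indS (S : set nat) (s p : R) (u : nat -> R) i : 1 <= s -> s * `|p| < 1 ->
  (forall k, S k -> `|u k| <= k%:R ^+ i) -> decay s (scale p (indS S u)).
Proof.
move=> s1 sp uk; have s0 : 0 <= s := le_trans ler01 s1.
have dg : decay s (iter i (@euler R) (geom p)).
  by apply: decay_iter_euler => //; apply: decay_geom.
apply: decay_dom dg => // n; rewrite iter_eulerE /scale /indS !normrM.
case: ifPn => [|_]; last by rewrite normr0 mul0r mulr_ge0.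
by rewrite inE => nS; rewrite ler_wpM2r// [leRHS]ger0_norm ?exprn_ge0// uk.
Qed.

End fsum_more.

(** * Inverses of polynomials as power series *)

Lemma fps_polyD (K : comNzRingType) (P Q : {poly K}) : fps_poly (P + Q) = fps_poly P + fps_poly Q.
Proof. by apply/funext => n; rewrite /fps_poly coefD. Qed.

Lemma fps_polyN (K : comNzRingType) (P : {poly K}) : fps_poly (- P) = - fps_poly P.
Proof. by apply/funext => n; rewrite /fps_poly coefN. Qed.

Lemma fps_poly_polyC (K : comNzRingType) (c : K) : fps_poly c%:P = fpsC c.
Proof. by apply/funext => n; rewrite /fps_poly coefC /fpsC; case: (n == 0%N). Qed.

Lemma fps_poly1 (K : comNzRingType) : fps_poly (1 : {poly K}) = 1.
Proof. by rewrite -polyC1 fps_poly_polyC. Qed.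

Lemma fps_polyX (K : comNzRingType) : fps_poly 'X = fpsX K.
Proof. by apply/funext => n; rewrite /fps_poly coefX. Qed.

(** The inverse of X - z is -1/z times the geometric series of ratio 1/z, which decays at rate [s]
    because |z| > s. *)
Lemma fps_prodXsub_inv (K : numFieldType) (s : K) (rs : seq K) : 0 <= s ->
  (forall z, z \in rs -> s < `|z|) ->
  exists2 I, decay s I & fps_poly (\prod_(z <- rs) ('X - z%:P)) * I = 1.
Proof.
move=> s0; elim: rs => [|z rs IH] zs.
  by exists 1; [exact: decay1|rewrite big_nil mulr1 fps_poly1].
have [I dI PI] : exists2 I, decay s I & fps_poly (\prod_(z <- rs) ('X - z%:P)) * I = 1.
  by apply: IH => y yrs; apply: zs; rewrite in_cons yrs orbT.
have sz : s < `|z| by apply: zs; rewrite mem_head.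
have z0 : z != 0 by rewrite -normr_gt0 (le_lt_trans s0).
have dz : decay s (geom z^-1).
  by apply: decay_geom => //; rewrite normfV ltr_pdivrMr ?mul1r// normr_gt0.
exists (fpsC (- z^-1) * geom z^-1 * I); first by decay_closed.
rewrite big_cons fps_polyM fps_polyD fps_polyN fps_poly_polyC fps_polyX.
have -> : (fpsX K - fpsC z) * fps_poly (\prod_(z <- rs) ('X - z%:P)) *
    (fpsC (- z^-1) * geom z^-1 * I) =
  (fpsC z * fpsC z^-1 * 1 - fpsC z^-1 * fpsX K) * geom z^-1 * (fps_poly (\prod_(z <- rs) ('X - z%:P)) * I).
  have -> : fpsC (- z^-1) = - fpsC z^-1 by apply/funext => n; rewrite fpsN /fpsC mulNrn.
  ring.
by rewrite -fpsC_mul divff// fpsC1 mulr1 PI geomV mulr1.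
Qed.

Lemma fps_poly_inv (K : numClosedFieldType) (s : K) (P : {poly K}) : 0 <= s -> P != 0 ->
  (forall z, root P z -> s < `|z|) -> exists2 I, decay s I & fps_poly P * I = 1.
Proof.
move=> s0 P0 zs; have [rs PE] := closed_field_poly_normal P.
have l0 : lead_coef P != 0 by rewrite lead_coef_eq0.
have [|I dI HI] := @fps_prodXsub_inv K s rs s0.
  by move=> z zrs; apply: zs; rewrite PE rootZ// root_prod_XsubC.
exists (fpsC (lead_coef P)^-1 * I); first by decay_closed.
rewrite {1}PE -mul_polyC fps_polyM fps_poly_polyC mulrACA HI -fpsC_mul divff//.
by rewrite fpsC1 mulr1.
Qed.

Definition fps_complex (R : realType) (a : fps R) : fps R[i] := fun n => (a n)%:C%C.

Lemma fps_complexM (R : realType) (a b : fps R) :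
  fps_complex (a * b) = fps_complex a * fps_complex b.
Proof.
apply/funext => n; rewrite /fps_complex !fpsM rmorph_sum; apply: eq_bigr => i _.
by rewrite rmorphM.
Qed.

(** The rate and the bound are complex numbers a priori; the rate is real because it exceeds a
    nonnegative real, and real parts suffice for the estimate. *)
Lemma decay_complex (R : realType) (q : R) (a : fps R) : 0 <= q ->
  decay q%:C%C (fps_complex a) -> decay q a.
Proof.
move=> q0 [t qt [C HC]].
have tE : t = (complex.Re t)%:C%C.
  by apply/esym/RRe_real/gtr0_real/(le_lt_trans _ qt); rewrite lecR.
exists (complex.Re t); first by rewrite -ltcR -tE.
exists (complex.Re C) => n; have := HC n.
rewrite /fps_complex normc_def /= expr0n addr0 sqrtr_sqr tE -rmorphXn -rmorphM.
by rewrite lecE => /andP[_].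
Qed.

(** * The polynomial (1 - x) f(x) and its zeros *)

Lemma gaps_bound (S : set nat) : proper_cofinite S ->
  exists2 N, (0 < N)%N & forall n, (N <= n)%N -> S n.
Proof.
move=> [_ finG _]; exists (\max_(k <- fset_set (gaps S)) k).+1 => // n Nn.
apply: contrapT => nS; have nG : n \in fset_set (gaps S).
  by rewrite in_fset_set// inE; split => //; apply: leq_trans Nn.
by move: Nn; rewrite (big_rem n)//= ltnNge leq_maxl.
Qed.

(** The polynomial (1 - x) f(x), kept over the reals and mapped to the complex numbers to speak of
    all roots. *)
Definition Qpoly (R : realType) (S : set nat) : {poly R} :=
  (1 - 'X) * (1 + \sum_(k <- fset_set (gaps S)) 'X^k) - 'X.

Section roots.
Variables (R : realType) (S : set nat).
Hypothesis hS : proper_cofinite S.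

Let S_gt0 : S `<=` [set k | (0 < k)%N]. Proof. by case: hS. Qed.
Let finG : finite_set (gaps S). Proof. by case: hS. Qed.

Local Notation Q := (Qpoly R S).
Local Notation QC := (map_poly (real_complex R) Q).
Local Notation f := (f_fps S R).

Lemma is_rootQ (z : R[i]) : is_root S z <-> root QC z.
Proof.
rewrite is_rootE fsbig_finite//= /root.
have -> : QC.[z] = (1 - z) * (1 + \sum_(k <- fset_set (gaps S)) z ^+ k) - z.
  rewrite /Qpoly rmorphB rmorphM rmorphB rmorphD rmorph1 /= map_polyX rmorph_sum.
  rewrite !hornerE horner_sum; congr (_ * (1 + _) - _); apply: eq_bigr => k _.
  by rewrite /= map_polyXn hornerXn.
by split => /eqP.
Qed.

Lemma Q_fps : (1 - fpsX R) * f = fps_poly Q.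
Proof.
(* The indicator of [S] is that of all naturals minus those of 0 and of the gaps. *)
have GE : indS S (fun=> 1) = geom 1 - 1 - fps_poly (\sum_(k <- fset_set (gaps S)) 'X^k) :> fps R.
  apply/funext => n; rewrite !fpsD !fpsN fps1 /fps_poly coef_sum /geom expr1n /indS.
  under eq_bigr do rewrite coefXn.
  have -> : \sum_(k <- fset_set (gaps S)) (n == k)%:R = (n \in fset_set (gaps S))%:R :> R.
    have [nG|nG] := boolP (n \in _).
      rewrite (big_rem n)//= eqxx big_seq_cond big1 ?addr0// => k; rewrite andbT.
      rewrite (mem_rem_uniq _ (fset_uniq _)) => /andP[/=].
      by rewrite eq_sym => /negPf ->.
    rewrite big_seq_cond big1// => k; rewrite andbT => kG.
    by case: eqP => // nk; move: nG; rewrite nk kG.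
  rewrite in_fset_set//; case: n => [|n].
    have -> : (0%N \in S) = false by apply/negP => /set_mem /S_gt0.
    have -> : (0%N \in gaps S) = false by apply/negP => /set_mem [].
    by rewrite !subr0 subrr.
  rewrite subr0; case: ifPn => nS.
    have -> : (n.+1 \in gaps S) = false by apply/negP => /set_mem [_]; apply; exact: set_mem.
    by rewrite subr0.
  have -> : n.+1 \in gaps S by apply/mem_set; split => // /mem_set; exact/negP.
  by rewrite subrr.
rewrite /f_fps GE /Qpoly fps_polyD fps_polyN fps_polyM !fps_polyD fps_polyN fps_polyX.
rewrite fps_poly1.
set H := fps_poly _; transitivity ((1 - fpsX R) * (1 + 1 + H) - (1 - fpsX R) * geom 1); first by ring.
by rewrite geom1V; ring.
Qed.

Lemma decay_scale_f (s x : R) : 1 <= s -> s * `|x| < 1 -> decay s (scale x f).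
Proof.
move=> s1 sx; have s0 : 0 <= s := le_trans ler01 s1.
rewrite /f_fps scaleD scaleN scale1; apply: decayD => //; first exact: decay1.
apply: decayN => //; apply: (@decay_scale_indS _ _ _ _ _ 0) => // k _.
by rewrite expr0 normr1.
Qed.

Lemma Q_scale (x : R) : (1 - fpsC x * fpsX R) * scale x f = scale x (fps_poly Q).
Proof.
rewrite -Q_fps scaleM; suff -> : scale x (1 - fpsX R) = 1 - fpsC x * fpsX R by [].
rewrite scaleD scaleN scale1; suff -> : scale x (fpsX R) = fpsC x * fpsX R by [].
apply/funext => -[|[|n]]; rewrite fpsCM /scale /fpsX ?mul0r ?mulr0//.
by rewrite mulrC.
Qed.

Lemma decay_1sub (x : R) : decay 1 (1 - fpsC x * fpsX R).
Proof. by have := @ler01 R; move=> ?; decay_closed. Qed.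

Lemma fsum_1sub (x : R) : fsum (1 - fpsC x * fpsX R) = 1 - x.
Proof.
have l01 := @ler01 R; have l11 := lexx (1 : R).
rewrite (fsumB l11) -?fpsC1 ?fsumC ?(fsumM l11) ?fsumC; try by decay_closed.
by rewrite [fsum (fpsX R)](mom0X l11) mulr1.
Qed.

(** At 1 the rescaled identity reads (1 - x) f(x) = Q(x) = 0, and x differs from 1. *)
Lemma fsum_f_root (x : R) : `|x| < 1 -> root Q x -> fsum (scale x f) = 0.
Proof.
move=> x1 rx; have l11 := lexx (1 : R).
have df : decay 1 (scale x f) by apply: decay_scale_f; rewrite ?mul1r.
have := fsumM l11 (decay_1sub x) df; rewrite Q_scale fsum_scale_poly (rootP rx) fsum_1sub.
move/esym/eqP; rewrite mulf_eq0 subr_eq0 => /orP[/eqP x1E|/eqP//].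
by move: x1; rewrite -x1E normr1 ltxx.
Qed.

Lemma fsum_indS_root (x : R) : `|x| < 1 -> root Q x ->
  fsum (scale x (indS S (fun=> 1))) = 1.
Proof.
move=> x1 rx; have l11 := lexx (1 : R).
have -> : scale x (indS S (fun=> 1)) = fpsC 1 - scale x f.
  by rewrite /f_fps scaleD scaleN scale1 fpsC1; ring.
rewrite (fsumB l11) ?fsumC ?fsum_f_root ?subr0//; first by decay_closed.
by apply: decay_scale_f; rewrite ?mul1r.
Qed.

Lemma root_QC (x : R) : root QC x%:C%C = root Q x.
Proof. by rewrite fmorph_root. Qed.

(** A sign change of Q on [0, 1] yields a zero p0 inside, so |p| <= p0 < 1 by minimality; p <= 0 is
    then excluded by comparing the sums of p^k and p0^k over [S]. *)
Lemma smallest_root_bounds (p : R) : smallest_root S p -> 0 < p < 1.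
Proof.
move=> [rp pmin]; have {}rp : root Q p by rewrite -root_QC; apply/is_rootQ.
have Q0 : Q.[0] = 1.
  rewrite /Qpoly !hornerE horner_sum big_seq_cond big1; first by ring.
  move=> k; rewrite andbT in_fset_set// => /set_mem [k0 _].
  by rewrite hornerXn expr0n gtn_eqF.
have Q1 : Q.[1] = -1 by rewrite /Qpoly !hornerE subrr mul0r sub0r.
have [p0 /andP[p00 p01] rp0] : exists2 x, 0 <= x <= 1 & root (- Q) x.
  by apply: poly_ivt; rewrite ?ler01// !hornerN Q0 Q1 opprK lerN10 ler01.
rewrite rootN in rp0.
have p0_neq0 : p0 != 0.
  by apply/eqP => E; move: rp0; rewrite E /root Q0 oner_eq0.
have p0_neq1 : p0 != 1.
  by apply/eqP => E; move: rp0; rewrite E /root Q1 oppr_eq0 oner_eq0.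
have {}p00 : 0 < p0 by rewrite lt_neqAle eq_sym p0_neq0.
have {}p01 : p0 < 1 by rewrite lt_neqAle p0_neq1.
have pp0 : `|p| <= p0.
  have : `|p%:C%C| <= `|p0%:C%C| by apply: pmin; apply/is_rootQ; rewrite root_QC.
  by rewrite !normc_def /= !expr0n !addr0 !sqrtr_sqr lecR (gtr0_norm p00).
have p1 : `|p| < 1 := le_lt_trans pp0 p01.
have p01' : `|p0| < 1 by rewrite gtr0_norm.
apply/andP; split; last by apply: le_lt_trans p1; exact: ler_norm.
rewrite ltNge; apply/negP => p_le0.
have l11 := lexx (1 : R); have l01 := @ler01 R.
have dp x : `|x| < 1 -> decay 1 (scale x (indS S (fun=> 1))).
  move=> x1; apply: (@decay_scale_indS _ _ _ _ _ 0); rewrite ?mul1r// => k _.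
  by rewrite expr0 normr1.
(* Both sums over [S] equal 1, so [d] sums to 0, while |p| <= p0 makes its terms nonnegative. *)
pose d := scale p0 (indS S (fun=> 1)) - scale p (indS S (fun=> 1)).
have dd : decay 1 d by apply: decayD => //; [exact: dp|apply: decayN => //; exact: dp].
have : fsum d = 0 by rewrite (fsumB l11) ?fsum_indS_root ?subrr//; exact: dp.
have [N N0 NS] := gaps_bound hS.
have pk k : p ^+ k <= p0 ^+ k.
  by rewrite (le_trans (ler_norm _))// normrX lerXn2r// nnegrE// ltW.
move=> fd0; suff : 0 < fsum d by rewrite fd0 ltxx.
(* This index lies in [S] because it is at least [N]; being odd, it gives p^k <= 0 < p0^k. *)
apply: (fsum_gt0 (k := N.*2.+1) l11 dd).
  move=> n; rewrite /d fpsD fpsN /scale /indS; case: ifP => _; last by rewrite !mul0r subrr.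
  by rewrite !mul1r subr_ge0.
have kS : N.*2.+1 \in S by apply/mem_set/NS; rewrite -addnn -addnS leq_addr.
rewrite /d fpsD fpsN /scale /indS kS.
rewrite !mul1r subr_gt0; apply: le_lt_trans (exprn_gt0 _ p00).
by rewrite exprn_odd_le0//= odd_double.
Qed.

End roots.

(** * Asymptotics of the variance *)

Section asymptotics.
Variables (R : realType) (S : set nat) (p : R).
Hypotheses (hS : proper_cofinite S) (hp : smallest_root S p).

Let S_gt0 : S `<=` [set k | (0 < k)%N]. Proof. by case: hS. Qed.
Let p0 : 0 < p. Proof. by have /andP[] := smallest_root_bounds hS hp. Qed.
Let p1 : p < 1. Proof. by have /andP[] := smallest_root_bounds hS hp. Qed.
Let l11 : 1 <= 1 :> R. Proof. exact: lexx. Qed.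
Let l01 : 0 <= 1 :> R. Proof. exact: ler01. Qed.
Let normp : `|p| = p. Proof. exact: gtr0_norm. Qed.

Local Notation Q := (Qpoly R S).
Local Notation f := (scale p (f_fps S R)).
Local Notation l := (scale p (l_fps S R)).
Local Notation l2 := (scale p (l2_fps S R)).
Local Notation d1 := (scale p (indS S (fun=> 1 : R))).

Lemma rootQp : root Q p.
Proof. by rewrite -root_QC; apply/is_rootQ => //; case: hp. Qed.

Lemma ln_nat_bounds k : S k -> 0 <= ln (k%:R : R) <= k%:R.
Proof.
move=> /S_gt0 /= k0; have k0' : 0 < k%:R :> R by rewrite ltr0n.
by rewrite ln_ge0 ?ler1n//= ltW// ln_sublinear.
Qed.

(** The weights 1, log k and (log k)^2 are at most 1, k and k^2 on [S]. *)
Lemma decay_weights (s : R) : 1 <= s -> s * p < 1 ->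
  [/\ decay s d1, decay s f, decay s l & decay s l2].
Proof.
move=> s1 sp; have sp' : s * `|p| < 1 by rewrite normp.
split; [|exact: decay_scale_f| |].
- by apply: (@decay_scale_indS _ _ _ _ _ 0) => // k _; rewrite expr0 normr1.
- apply: (@decay_scale_indS _ _ _ _ _ 1) => // k /ln_nat_bounds /andP[k0 k1].
  by rewrite ger0_norm// expr1.
- apply: (@decay_scale_indS _ _ _ _ _ 2) => // k /ln_nat_bounds /andP[k0 k1].
  by rewrite ger0_norm ?exprn_ge0// lerXn2r// nnegrE.
Qed.

Let dec1 : [/\ decay 1 d1, decay 1 f, decay 1 l & decay 1 l2].
Proof. by apply: decay_weights; rewrite ?mul1r. Qed.

Lemma mom_d1 i : mom i d1 = moment S p i 0.
Proof. by rewrite momentE. Qed.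

Lemma mom_l i : mom i l = moment S p i 1.
Proof. by rewrite momentE. Qed.

Lemma mom_l2 i : mom i l2 = moment S p i 2.
Proof. by rewrite momentE. Qed.

Lemma mom_f i : mom i.+1 f = - moment S p i.+1 0.
Proof.
have [dd1 _ _ _] := dec1.
rewrite /f_fps scaleD scaleN scale1 (momD l11) ?momS1 ?(momN l11) ?mom_d1 ?add0r//.
  exact: decay1.
exact: decayN.
Qed.

Lemma mom0_f : mom 0 f = 0.
Proof. by apply: fsum_f_root => //; [rewrite normp|exact: rootQp]. Qed.

Lemma moment1_gt0 : 0 < moment S p 1 0.
Proof.
have [dd1 _ _ _] := dec1; have [N N0 NS] := gaps_bound hS.
rewrite -mom_d1; apply: (fsum_gt0 (k := N) l11).
- exact: decay_euler.
- move=> n; rewrite /= /euler /scale /indS !mulr_ge0// ?exprn_ge0 ?(ltW p0)//.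
  by case: ifP.
- have kS : N \in S by apply/mem_set/NS.
  by rewrite /= /euler /scale /indS kS mul1r mulr_gt0 ?exprn_gt0// ltr0n.
Qed.

(* [K * b1] is the sum of [(ln k - (L / K) k) ^ 2] against [p ^ k];
   it vanishes only if [ln k] is proportional to [k] on [S], which fails at
   [k = N, 2 N, 4 N]. *)
Lemma b1_gt0 : 0 < b1_formula S p.
Proof.
have [dd1 _ dl dl2] := dec1; have [N N0 NS] := gaps_bound hS.
have K0 := moment1_gt0; rewrite /b1_formula /=.
set K := moment S p 1 0 in K0 *; set L := moment S p 0 1; pose x := L / K.
pose h := l2 - fpsC (2 * x) * euler l + fpsC (x ^+ 2) * euler (euler d1).
have dh : decay 1 h by rewrite /h; decay_closed.
have hE n : h n = if n \in S then (ln n%:R - x * n%:R) ^+ 2 * p ^+ n else 0.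
  rewrite /h !fpsD fpsN !fpsCM /euler /scale /l2_fps /l_fps /indS.
  by case: ifP => _; ring.
have hsum : fsum h = moment S p 0 2 - 2 * x * moment S p 1 1 + x ^+ 2 * moment S p 2 0.
  rewrite -mom_l2 -mom_l -mom_d1 /h.
  rewrite (fsumD l11) ?(fsumB l11) ?(fsumM l11) ?fsumC//; by decay_closed.
have -> : L ^+ 2 * moment S p 2 0 / K ^+ 3 - 2 * L * moment S p 1 1 / K ^+ 2 +
    moment S p 0 2 / K = fsum h / K.
  by rewrite hsum /x; field; rewrite gt_eqF.
rewrite divr_gt0//.
have pn n : 0 < p ^+ n by rewrite exprn_gt0.
have h0 n : 0 <= h n.
  by rewrite hE; case: ifP => // _; rewrite mulr_ge0 ?sqr_ge0 ?ltW.
rewrite ltNge; apply/negP => hle.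
have lnE n : (N <= n)%N -> ln n%:R = x * n%:R.
  move=> Nn; apply/eqP; rewrite -subr_eq0 -sqrf_eq0; apply/negP => /negP ne0.
  move: hle; apply/negP; rewrite -ltNge; apply: (fsum_gt0 (k := n) l11 dh h0).
  have nS : n \in S by apply/mem_set/NS.
  by rewrite hE nS mulr_gt0// lt_neqAle eq_sym ne0 sqr_ge0.
have N0' : 0 < N%:R :> R by rewrite ltr0n.
(* The first two relations give ln 2 = x N, the first and third 2 ln 2 = 3 x N, so ln 2 would be
   0. *)
have e1 := lnE N (leqnn N).
have e2 : ln 2 + ln N%:R = x * (2 * N%:R).
  by rewrite -lnM ?posrE// -natrM lnE// leq_pmull.
have e4 : ln 2 + (ln 2 + ln N%:R) = x * (2 * (2 * N%:R)).
  by rewrite -!lnM ?posrE ?mulr_gt0// -!natrM lnE// mulnA leq_pmull.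
have : 0 < ln 2 :> R by rewrite ln_gt0// ltr1n.
move: e1 e2 e4; have -> : x * (2 * (2 * N%:R)) = 4 * (x * N%:R) by ring.
have -> : x * (2 * N%:R) = 2 * (x * N%:R) by ring.
lra.
Qed.

Variables (r q : R).
Hypothesis hr : second_smallest_modulus S p r.
Hypotheses (pq : p < q) (q1 : q < 1) (qr : q < r).

Let q0 : 0 < q. Proof. exact: lt_trans pq. Qed.

(* Removing the simple zero [p] from [Q] leaves a polynomial whose complex zeros
   all have modulus at least [r > q], hence a decaying inverse. *)
Lemma decay_pole_removed : decay (q / p) ((1 - fpsX R) * scale p (c_fps S R)).
Proof.
have [dd1 df _ _] := dec1.
have [V QV] := factor_theorem _ _ rootQp.
have sXp : scale p (fps_poly ('X - p%:P)) = - (fpsC p * (1 - fpsX R)).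
  apply/funext => -[|[|n]]; rewrite fpsN fpsCM /scale /fps_poly coefB coefX coefC;
    by rewrite fpsD fpsN fps1 /fpsX /=; ring.
(* Simplicity of the zero: first moments in (1 - p x) f(p x) = -p (1 - x) V(p x) give -(1 - p) K = p
   V(p), where K = [moment S p 1 0] is positive. *)
have Vp : V.[p] != 0.
  have E : (1 - fpsC p * fpsX R) * f = - (fpsC p * (1 - fpsX R)) * scale p (fps_poly V).
    by rewrite Q_scale// QV mulrC fps_polyM scaleM sXp.
  have dV : decay 1 (scale p (fps_poly V)) by exact: decay_scale_poly.
  have dX : decay 1 (1 - fpsX R) := decay_e l11.
  have dpX : decay 1 (fpsC p * (1 - fpsX R)) by decay_closed.
  have dpX' : decay 1 (- (fpsC p * (1 - fpsX R))) by decay_closed.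
  have := congr1 (mom 1) E; rewrite (mom1M l11)//; last exact: decay_1sub.
  rewrite (mom1M l11)// mom0_f mulr0 add0r mom_f (momN l11)// (momN l11)//.
  rewrite (mom0M l11)//; last exact: decayC.
  rewrite (mom1M l11)//; last exact: decayC.
  rewrite (mom0e l11) (momSe l11) [mom 0 (fpsC p)]fsumC [mom 0 (1 - fpsC _ * _)]fsum_1sub.
  rewrite [mom 0 (scale p (fps_poly V))]fsum_scale_poly !mulr0 oppr0 mul0r addr0 add0r.
  rewrite mulrN1 opprK => H; apply/eqP => V0; move: H; rewrite V0 mulr0.
  by apply/eqP; rewrite mulf_eq0 subr_eq0 oppr_eq0 !gt_eqF// moment1_gt0.
(* This is (1 - x/p) c(x), the series to be bounded before rescaling by [p]. *)
pose g := - (fpsC p^-1 * (fpsX R - fpsC p)) * c_fps S R.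
have gE : (1 - fpsX R) * scale p (c_fps S R) = scale p g.
  rewrite /g scaleM; congr (_ * _).
  apply/funext => -[|[|n]]; rewrite /scale !fpsN fpsCM !fpsD !fpsN fps1 /fpsX /fpsC /= ?mulr1n ?mulr0n.
  - by rewrite expr0; field; rewrite gt_eqF.
  - by rewrite expr1; field; rewrite gt_eqF.
  - by rewrite !subr0 mulr0 oppr0 mul0r.
(* As V (x - p) = (1 - x) f and f c = 1, the series [g] is a polynomial of degree 1 divided by V. *)
have Vg : fps_poly V * g = - (fpsC p^-1 * (1 - fpsX R)).
  have QVf : (1 - fpsX R) * f_fps S R = fps_poly V * (fpsX R - fpsC p).
    by rewrite Q_fps// QV fps_polyM fps_polyD fps_polyN fps_polyX fps_poly_polyC.
  transitivity (- (fpsC p^-1 * (fps_poly V * (fpsX R - fpsC p) * c_fps S R))); first by rewrite /g; ring.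
  by rewrite -QVf -mulrA c_fpsE// mulr1.
(* V is inverted over the complex numbers, where it splits into linear factors. *)
have [I dI VI] : exists2 I, decay q%:C%C I &
    fps_poly (map_poly (real_complex R) V) * I = 1.
  apply: fps_poly_inv.
  - by rewrite lecR ltW.
  - by rewrite map_poly_eq0; apply: contraNneq Vp => ->; rewrite horner0.
  move=> z Vz; have rz : root (map_poly (real_complex R) Q) z.
    by rewrite QV rmorphM rootM Vz.
  (* A zero of V is a zero of Q other than [p], because V(p) is nonzero; hence its modulus is at
     least [r]. *)
  have zp : z != p%:C%C.
    by apply: contraNneq Vp => zE; move: Vz; rewrite zE fmorph_root.
  have [_ /(_ z)] := hr; rewrite is_rootQ// => /(_ rz zp); apply: lt_le_trans.
  by rewrite ltcR.
rewrite gE.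
have dg : decay q g.
  apply: decay_complex; first exact: ltW.
  have -> : fps_complex g = fps_complex (- (fpsC p^-1 * (1 - fpsX R))) * I.
    rewrite -Vg fps_complexM.
    have -> : fps_complex (fps_poly V) = fps_poly (map_poly (real_complex R) V).
      by apply/funext => n; rewrite /fps_complex /fps_poly coef_map.
    by rewrite mulrAC VI mul1r.
  apply: decayM => //; first by rewrite lecR ltW.
  apply: (@decay_finite _ _ _ _ 2); first by rewrite lecR ltW.
  move=> -[|[|n]]// _; rewrite /fps_complex fpsN fpsCM fpsD fpsN fps1 /fpsX /=.
  by rewrite subr0 mulr0 oppr0.
(* Rescaling by [p] divides the rate by [p]. *)
have [t qt [C HC]] := dg; exists (t / p); first by rewrite ltr_pM2r// invr_gt0.
by exists C => n; rewrite /scale normrM normrX normp -mulrA -exprMn mulrCA divff ?mulr1 ?gt_eqF.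
Qed.

(** The general expansion is applied to the series rescaled by [p] at rate s = q / p, so that 1/s is
    the ratio p / q of the error term. *)
Lemma unif_var_asymptotics :
  (fun n : nat => unif_var (compositions S n) (@logB R)) =
    (fun n : nat => b1_formula S p * n%:R + b0_formula S p)
    +O_\oo (fun n : nat => n%:R ^+ 2 * (p / q) ^+ n).
Proof.
have s1 : 1 < q / p by rewrite ltr_pdivlMr// mul1r.
have sp : q / p * p < 1 by rewrite divfK// gt_eqF.
have [dd1 df dl dl2] := decay_weights (ltW s1) sp.
have fc : f * scale p (c_fps S R) = 1 by rewrite -scaleM c_fpsE// scale1.
have fm1 : f * scale p (m1_fps S R) = l * scale p (c_fps S R).
  by rewrite -!scaleM m1_fpsE.
have fm2 : f * scale p (m2_fps S R) = l2 * scale p (c_fps S R) + l * scale p (m1_fps S R) *+ 2.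
  by rewrite -!scaleM mulr2n -!scaleD m2_fpsE// mulr2n.
have f1 : mom 1 f < 0 by rewrite mom_f oppr_lt0 moment1_gt0.
have [C] := variance_asymptotics s1 df dl dl2 decay_pole_removed fc fm1 fm2 mom0_f f1.
rewrite /= !mom_f !opprK !mom_l !mom_l2 => HC.
(* [C] comes without a sign, so a positive constant is built from it. *)
apply/eqaddOP/bigO_exP; exists (`|C| + 1); first by rewrite ltr_wpDl.
apply: filterS HC => n []; rewrite /scale pmulr_lgt0 ?exprn_gt0// => cn0.
have pn0 : p ^+ n != 0 by rewrite expf_neq0// gt_eqF.
(* The factor p^n cancels in quotients, so the rescaling leaves mean and variance unchanged. *)
have ratio x : x * p ^+ n / (c_fps S R n * p ^+ n) = x / c_fps S R n.
  by rewrite -mulf_div divff// mulr1.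
rewrite !ratio -unif_varE ?gt_eqF// invf_div => H.
have E0 : 0 <= n%:R ^+ 2 * (p / q) ^+ n.
  by rewrite mulr_ge0 ?exprn_ge0// divr_ge0// ltW.
rewrite /= [X in _ * X]ger0_norm//.
by apply: (le_trans H); rewrite ler_wpM2r// (le_trans (ler_norm _))// lerDl.
Qed.

End asymptotics.

Unset Implicit Arguments.

Theorem theorem7 (R : realType) (S : set nat) (p r : R)
    (hS : proper_cofinite S)
    (hp : smallest_root S p)
    (hr : second_smallest_modulus S p r) :
  exists b1 b0 : R,
    [/\ 0 < b1,
        forall q : R, p < q -> q < Num.min 1 r ->
          (fun n : nat => unif_var (compositions S n) (@logB R)) =
            (fun n : nat => b1 * n%:R + b0)
            +O_\oo (fun n : nat => n%:R ^+ 2 * (p / q) ^+ n),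
        b1 = b1_formula S p
      & b0 = b0_formula S p].
Proof.
exists (b1_formula S p), (b0_formula S p); split => //; first exact: b1_gt0.
move=> q pq; rewrite lt_min => /andP[q1 qr].
exact: (unif_var_asymptotics hS hp hr).
Qed.
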